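(* Let $Y_j=\theta^*_{z_j^*}+\epsilon_j\in\mathbb{R}^d$, $j\in[p]$, with $\epsilon_j\sim N(0,I_d)$ independent, $z^*\in[k]^p$ and $\theta_1^*,\dots,\theta_k^*\in\mathbb{R}^d$, and let $\Delta_{\min}=\min_{1\le a\ne b\le k}\|\theta_a^*-\theta_b^*\|$. Assume $$\frac{\Delta_{\min}^2}{k^2(kd/p+1)}\to\infty,\qquad \frac pk\to\infty,$$ and $\min_{a\in[k]}\sum_{j=1}^p\mathbf 1\{z_j^*=a\}\ge\frac{\alpha p}{k}$ for some constant $\alpha>0$. Suppose the initializer $z^{(0)}$ of Lloyd's algorithm satisfies $$\ell(z^{(0)},z^* )=o\left(\frac{p\Delta_{\min}^2}{k}\right)$$ with probability at least $1-\eta$. Then the Lloyd iterates $z^{(t)}$ satisfy $$\ell(z^{(t)},z^* )\le p\exp\left(-(1+o(1))\frac{\Delta_{\min}^2}{8}\right)+\frac12\ell(z^{(t-1)},z^* )\qquad\text{for all }t\ge1,$$ with probability at least $1-\eta-\exp(-\Delta_{\min})-p^{-1}$.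
   Context: $[m]=\{1,\dots,m\}$, $\|\cdot\|$ is the Euclidean norm. The loss is $\ell(z,z^* )=\sum_{j=1}^p\|\theta^*_{z_j}-\theta^*_{z_j^*}\|^2$. Lloyd's algorithm: for $z\in[k]^p$ and $a\in[k]$ let $\widehat\theta_a(z)=\frac{\sum_{j=1}^p\mathbf 1\{z_j=a\}Y_j}{\sum_{j=1}^p\mathbf 1\{z_j=a\}}$ (with $0/0=0$). Starting from $z^{(0)}\in[k]^p$ (possibly depending on the data), set $z_j^{(t)}\in\operatorname{argmin}_{a\in[k]}\|Y_j-\widehat\theta_a(z^{(t-1)})\|^2$ for $j\in[p]$, $t\ge1$. Asymptotic conventions: one considers a sequence of problem instances (indexed by $p\to\infty$) in which $k,d,z^*,\theta^*,\eta$ may depend on $p$; $\alpha$ is fixed. $o(1)$ denotes a deterministic sequence tending to $0$, not depending on $t$. ''$\ell(z^{(0)},z^* )=o(a_p)$ with probability at least $1-\eta$'' means that there is a deterministic sequence $e_p$ with $e_p/a_p\to0$ and $\mathbb{P}(\ell(z^{(0)},z^* )\le e_p)\ge1-\eta$. The conclusion is for all sufficiently large $p$. *)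

(* Defs.v *)
From HB Require Import structures.
From mathcomp Require Import all_boot all_order all_algebra.
From mathcomp Require Import all_classical all_reals all_analysis.

Set Implicit Arguments.
Unset Strict Implicit.
Unset Printing Implicit Defensive.
Import Order.TTheory GRing.Theory Num.Theory.
Import numFieldNormedType.Exports.

Local Open Scope classical_set_scope.
Local Open Scope ring_scope.

(* The library norm `|v| on matrices is the sup norm, hence this definition. *)
Definition enorm (R : realType) (n : nat) (v : 'rV[R]_n) : R :=
  Num.sqrt (\sum_(i < n) v 0 i ^+ 2).

Section gaussian_noise.
Context {d : measure_display} {T : measurableType d} {R : realType}.
Variable P : probability T R.

Definition mutually_independent (I : finType) (F : I -> set (set T)) : Prop :=
  forall (J : {set I}) (A : I -> set T),
    (forall i, i \in J -> F i (A i)) ->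
    P (\bigcap_(i in [set` J]) A i) = (\prod_(i in J) P (A i))%E.

Definition coordinate (n : nat) (X : T -> 'rV[R]_n) (i : 'I_n) : T -> R :=
  fun w => X w 0 i.

(* The law N(0, I_n): the coordinates are i.i.d. N(0, 1). *)
Definition std_gaussian_vector (n : nat) (X : T -> 'rV[R]_n) : Prop :=
  [/\ forall i, measurable_fun [set: T] (coordinate X i),
      forall i (B : set R), measurable B ->
        P (coordinate X i @^-1` B) = normal_prob 0 1 B
    & mutually_independent
        (fun i => preimage_set_system [set: T] (coordinate X i) measurable)].

(* [g_sigma_preimage (coordinate X)] is the sigma-algebra generated by X. *)
Definition independent_vectors (I : finType) (n : nat)
    (X : I -> T -> 'rV[R]_n) : Prop :=
  mutually_independent (fun j => g_sigma_preimage (coordinate (X j))).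

End gaussian_noise.

Section clustering.
Context {R : realType} {p k d : nat}.
Implicit Types (z : {ffun 'I_p -> 'I_k}) (theta : 'I_k -> 'rV[R]_d)
  (Y : 'I_p -> 'rV[R]_d).

(* The infimum is over a finite set, so it is a minimum as soon as 1 < k;
   it is 0 (the value of inf on the empty set) when k <= 1. *)
Definition Delta_min theta : R :=
  inf [set enorm (theta ab.1 - theta ab.2) | ab in
        [set ab : 'I_k * 'I_k | ab.1 != ab.2]].

Definition loss theta z zstar : R :=
  \sum_(j < p) enorm (theta (z j) - theta (zstar j)) ^+ 2.

Definition cluster_size z (a : 'I_k) : nat := \sum_(j < p) (z j == a).

(* An empty cluster has center 0, since 0^-1 = 0. *)
Definition center Y z (a : 'I_k) : 'rV[R]_d :=
  (cluster_size z a)%:R^-1 *: \sum_(j < p | z j == a) Y j.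

(* z' is a possible outcome of one Lloyd iteration from z; ties in the argmin
   may be broken arbitrarily. *)
Definition lloyd_step Y z z' : Prop :=
  forall (j : 'I_p) (b : 'I_k),
    enorm (Y j - center Y z (z' j)) ^+ 2 <= enorm (Y j - center Y z b) ^+ 2.

Definition random_labels (disp : measure_display) (T : measurableType disp)
    (Z : T -> {ffun 'I_p -> 'I_k}) : Prop :=
  forall z, measurable [set w | Z w = z].

End clustering.

(* Main.v *)
(** A Lloyd update moves sample j from its true cluster a to b only if the noise of
    j is large along theta_a - theta_b, along the mean noise of one of the true
    clusters a and b, or along the displacement of one of the two estimated centers
    caused by the current labelling errors.  The first two alternatives do not
    involve the current labels: they define [ideal_loss], whose mean is at most
    p exp (- (1 - o(1)) Delta^2 / 8), so Markov's inequality costs exp (- Delta).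
    For the last one, with probability at least 1 - 1/p all partial noise sums
    satisfy |sum_(j in S) eps_j|^2 <= 8 (p + d) |S|; on this event the displacements
    are controlled by the current loss, uniformly over data-dependent labels, and
    contribute at most half of it.  Hence one event serves all iterations. *)

Require Import Defs.
From HB Require Import structures.
From mathcomp Require Import all_boot all_order all_algebra.
From mathcomp Require Import all_classical all_reals all_analysis.
From mathcomp Require Import measurable_realfun normal_distribution ring lra.

Set Implicit Arguments.
Unset Strict Implicit.
Unset Printing Implicit Defensive.
Import Order.TTheory GRing.Theory Num.Theory.
Import numFieldNormedType.Exports.

Local Open Scope classical_set_scope.
Local Open Scope ring_scope.

(** * Change of measure and the standard normal distribution *)

(** The constant 8 is the price of crossing the bisecting hyperplane of two centers at squared
    distance [D]: the noise along their difference, of variance [D], must exceed [D / 2], which has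
    probability at most exp (- D / 8). All other effects are paid from a slack [dl], kept fixed
    until it is sent to 0 at the very end. The obstacle is that the current labels depend on all the
    noise, so the displacement of a center is not independent of the noise of sample [j]. Errors due
    to displacements are therefore not bounded one sample at a time: samples facing the same
    displacement are grouped, their inequalities are added, and Cauchy-Schwarz then involves only
    the noise sum over the group, whatever that group is. The mean noise of a true cluster, in
    contrast, is a fixed linear combination, so its inner product with the noise of [j] has an
    explicit exponential moment once the noise of [j] is frozen. Initial labels that depend on the
    data do no harm: they enter through a union bound only. *)

Section change_of_measure.
Local Open Scope ereal_scope.
Context d1 d2 (T : measurableType d1) (U : measurableType d2) (R : realType).
Variables (mu : {measure set T -> \bar R}) (nu : {measure set U -> \bar R}).
Variables (X : T -> U) (g : T -> R).
Hypotheses (mX : measurable_fun [set: T] X) (mg : measurable_fun [set: T] g).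
Hypothesis g0 : forall w, (0 <= g w)%R.
Hypothesis nuE : forall B, measurable B ->
  nu B = \int[mu]_(w in X @^-1` B) (g w)%:E.

Import HBNNSimple.

(** Density and pushforward are treated together because the normal density needs the former ([X]
    the identity), the law of a variable the latter ([g] constant 1), and the independence argument
    both at once. *)
Lemma integral_change_of_measure (f : U -> \bar R) :
  (forall x, 0 <= f x) -> measurable_fun [set: U] f ->
  \int[nu]_x f x = \int[mu]_w (f (X w) * (g w)%:E).
Proof.
move=> f0 mf.
pose h := nnsfun_approx measurableT mf.
have mhX n : measurable_fun [set: T] (EFin \o h n \o X).
  by do 2 apply: measurableT_comp => //.
have -> : \int[nu]_x f x = limn (fun n => \int[nu]_x (h n x)%:E).
  rewrite -monotone_convergence//.
  - apply: eq_integral => y _; apply/esym/cvg_lim => //.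
    by apply: cvg_nnsfun_approx => // *.
  - by move=> n; apply/measurable_EFinP.
  - by move=> n x _; rewrite lee_fin.
  - by move=> x _ a b ab; rewrite lee_fin; exact/lefP/nd_nnsfun_approx.
have -> : \int[mu]_w (f (X w) * (g w)%:E) =
    limn (fun n => \int[mu]_w ((h n (X w))%:E * (g w)%:E)).
  rewrite -monotone_convergence//.
  - apply: eq_integral => y _; apply/esym/cvg_lim => //.
    apply: cvgeZr => //.
    exact: (cvg_nnsfun_approx measurableT mf (fun x _ => f0 x) (x:=X y)).
  - by move=> n; apply: emeasurable_funM; [exact: mhX|exact/measurable_EFinP].
  - by move=> n x _; rewrite mule_ge0 ?lee_fin.
  - by move=> x _ a b ab; rewrite lee_wpmul2r ?lee_fin//; exact/lefP/nd_nnsfun_approx.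
congr (limn _); apply/funext => n.
have mpre r : measurable (X @^-1` (h n @^-1` [set r])).
  by rewrite -[X in measurable X]setTI; apply: mX => //.
transitivity (\int[nu]_x
   (\sum_(y \in range (h n)) (y * \1_(h n @^-1` [set y]) x)%:E)).
  by apply: eq_integral => t _; rewrite /= fimfunE -fsumEFin.
rewrite ge0_integral_fsum//; last 2 first.
- by move=> y; apply/measurable_EFinP; apply: measurable_funM.
- by move=> m y Ey; exact: nnfun_muleindic_ge0.
transitivity (\int[mu]_w (\sum_(y \in range (h n))
    (y * \1_(h n @^-1` [set y]) (X w))%:E * (g w)%:E)); last first.
  apply: eq_integral => w _.
  rewrite -ge0_mule_fsuml => [|y]; last exact: nnfun_muleindic_ge0.
  by rewrite fsumEFin // -(fimfunE _ _).
have mY r : measurable_fun [set: T] (fun w => (r * \1_(h n @^-1` [set r]) (X w))%:E).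
  apply/measurable_EFinP; apply: measurable_funM => //.
  exact: measurableT_comp.
rewrite ge0_integral_fsum//; last 2 first.
- by move=> y; apply: emeasurable_funM => //; apply/measurable_EFinP.
- by move=> y x _; rewrite mule_ge0 //= ?lee_fin; [exact: nnfun_muleindic_ge0|exact: g0].
apply: eq_fsbigr => r rhn.
rewrite integralZl_indic_nnsfun// integral_indic// setIT nuE//.
rewrite integral_mkcond -ge0_integralZl//=.
- apply: eq_integral => w _; rewrite EFinM -muleA; congr (_ * _).
  rewrite patchE indicE.
  have -> : (X w \in h n @^-1` [set r]) = (w \in X @^-1` (h n @^-1` [set r])).
    by apply/idP/idP; rewrite !inE.
  by case: (w \in _); rewrite ?mul1e ?mul0e.
- by apply/(measurable_restrictT _ _).1 => //; apply: measurable_funTS; apply/measurable_EFinP.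
- by move=> w _; apply: erestrict_ge0 => t _; rewrite lee_fin.
- by move: rhn; rewrite inE => -[t _ <-]; rewrite lee_fin.
Qed.

End change_of_measure.

Section standard_normal.
Context {R : realType}.
Local Open Scope ereal_scope.

Lemma integral_normal_probE (f : R -> R) :
  (forall x, (0 <= f x)%R) -> measurable_fun [set: R] f ->
  \int[normal_prob 0 1]_x (f x)%:E =
  \int[lebesgue_measure]_x (f x * normal_pdf 0 1 x)%:E.
Proof.
move=> f0 mf.
rewrite (@integral_change_of_measure _ _ _ _ _ lebesgue_measure (normal_prob 0 1) id
  (normal_pdf 0 1))//.
- exact: measurable_normal_pdf.
- by move=> w; exact: normal_pdf_ge0.
- exact/measurable_EFinP.
Qed.

Lemma integral_normal_expR (t : R) :
  \int[normal_prob 0 1]_x (expR (t * x))%:E = (expR (t ^+ 2 / 2))%:E.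
Proof.
rewrite integral_normal_probE//; last first.
  by apply: measurableT_comp => //; exact: measurable_funM.
(* Completing the square shifts the N(0, 1) density to that of N(t, 1). *)
transitivity (\int[lebesgue_measure]_x ((expR (t ^+ 2 / 2))%:E * (normal_pdf t 1 x)%:E)).
  apply: eq_integral => x _; rewrite -EFinM; congr (_%:E).
  rewrite !normal_pdfE ?oner_neq0// /normal_fun.
  rewrite !(mulrCA _ (normal_peak 1)) -!expRD; congr (_ * expR _)%R.
  by field.
rewrite ge0_integralZl//.
- by rewrite integral_normal_pdf mule1.
- by apply/measurable_EFinP; exact: measurable_normal_pdf.
- by move=> x _; rewrite lee_fin normal_pdf_ge0.
Qed.

(** The integrand times the density is [r] times the N(0, r^2) density with r = (1 - 2s)^(-1/2), so
    the integral equals [r]. The bound r <= exp (2s) follows from (1 + 2s)^2 (1 - 2s) >= 1, valid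
    for s <= 1/4. *)
Lemma integral_normal_expR_sqr (s : R) : (0 <= s <= 1 / 4)%R ->
  \int[normal_prob 0 1]_x (expR (s * x ^+ 2))%:E <= (expR (2 * s))%:E.
Proof.
move=> /andP[s0 s1].
have u0 : (0 < 1 - 2 * s)%R by lra.
pose r : R := ((Num.sqrt (1 - 2 * s))^-1)%R.
have r0 : (0 < r)%R by rewrite invr_gt0 sqrtr_gt0.
have r2 : (r ^+ 2 = (1 - 2 * s)^-1)%R by rewrite /r exprVn sqr_sqrtr ?ltW.
rewrite integral_normal_probE//; last first.
  by apply: measurableT_comp => //; apply: measurable_funM => //; exact: measurable_funX.
have peakE : (normal_peak 1 = r * normal_peak r :> R)%R.
  rewrite /normal_peak expr1n mul1r -mulrnAr sqrtrM ?sqr_ge0// sqrtr_sqr gtr0_norm//.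
  by rewrite invfM mulrA divff ?mul1r// gt_eqF.
rewrite (_ : \int[lebesgue_measure]_x _ =
    \int[lebesgue_measure]_x (r%:E * (normal_pdf 0 r x)%:E)); last first.
  apply: eq_integral => x _; rewrite -EFinM; congr (_%:E).
  rewrite !normal_pdfE ?oner_neq0// ?gt_eqF// /normal_fun.
  rewrite peakE !(mulrCA _ (r * normal_peak r)%R) -mulrA -expRD; congr (_ * (_ * expR _))%R.
  by rewrite r2; field; rewrite gt_eqF.
rewrite ge0_integralZl//.
- rewrite integral_normal_pdf mule1 lee_fin.
  rewrite -(@ler_pXn2r _ 2)// ?nnegrE ?expR_ge0// ?(ltW r0)// r2.
  rewrite -[leLHS]mul1r ler_pdivrMr//.
  have e1 := expR_ge1Dx (2 * s).
  apply: (@le_trans _ _ ((1 + 2 * s) ^+ 2 * (1 - 2 * s)))%R.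
    nra.
  rewrite ler_wpM2r ?(ltW u0)// ler_pXn2r// nnegrE ?expR_ge0//; lra.
- by apply/measurable_EFinP; exact: measurable_normal_pdf.
- by move=> x _; rewrite lee_fin normal_pdf_ge0.
- by rewrite lee_fin ltW.
Qed.

End standard_normal.

(** * Products of independent functions *)

Section independence.
Context d (T : measurableType d) (R : realType) (P : probability T R).

(* The factors are released from indicators to general functions one index at a
   time: with the other factors frozen, both sides are measures in the event. *)
Lemma integral_prod_independent (I : finType) (F : I -> set (set T))
    (X : I -> T -> R) (c : I -> R) :
  mutually_independent P F ->
  (forall i A, F i A -> measurable A) ->
  (forall i B, measurable B -> F i (X i @^-1` B)) ->
  (forall i w, 0 <= X i w) ->
  (forall i, \int[P]_w (X i w)%:E = (c i)%:E)%E ->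
  (\int[P]_w (\prod_i X i w)%:E = (\prod_i c i)%:E)%E.
Proof.
move=> indep Fm FX X0 Xc.
have mX i : measurable_fun [set: T] (X i).
  by move=> _ B mB; rewrite setTI; exact/(Fm i)/FX.
have c0 i : 0 <= c i.
  by rewrite -lee_fin -Xc; apply: integral_ge0 => w _; rewrite lee_fin.
have Pfin A : measurable A -> ((fine (P A))%:E = P A)%E.
  by move=> mA; rewrite fineK// fin_num_measure.
(* [s] lists the factors that are already general functions; the others are still indicators of
   arbitrary events [A i]. *)
suff H (s : seq I) : uniq s -> forall A : I -> set T, (forall i, F i (A i)) ->
    (\int[P]_w (\prod_i (if i \in s then X i w else \1_(A i) w))%:E =
     (\prod_i (if i \in s then c i else fine (P (A i))))%:E)%E.
  have FT i : F i setT by rewrite -(preimage_setT (X i)); exact: FX.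
  have := H (enum I) (enum_uniq _) (fun=> setT) FT.
  under eq_bigr do rewrite mem_enum/=.
  move=> <-; apply: eq_integral => w _.
  by congr (_%:E); apply: eq_bigr => i _; rewrite mem_enum.
elim: s => [_ A FA|i0 s IH /= /andP[i0s us] A FA].
  have mA i : measurable (A i) by exact/(Fm i)/FA.
  transitivity (\int[P]_w (\1_(\bigcap_i A i) w)%:E)%E.
    apply: eq_integral => w _; congr (_%:E); rewrite indicE.
    case: (boolP (w \in _)); rewrite ?inE ?notin_setE => H.
      by rewrite big1// => i _; rewrite indicE mem_set//; exact: H.
    move: H => /existsNP[i] /not_implyP[_ nA].
    by rewrite (bigD1 i)//= indicE memNset// mul0r.
  have mcap : measurable (\bigcap_i A i).
    by apply: fin_bigcap_measurable => //; exact: finite_finset.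
  rewrite integral_indic// setIT.
  have setE : [set` [set: I]%SET] = [set: I].
    by apply/seteqP; split => // i _ /=; rewrite inE.
  have := indep [set: I]%SET A (fun i _ => FA i); rewrite setE => PA.
  apply: (etrans PA); rewrite (big_morph EFin (@EFinM R) erefl); apply: eq_big => [i|i _]; first by rewrite inE.
  by rewrite Pfin.
pose g w := \prod_(i | i != i0) (if i \in s then X i w else \1_(A i) w).
pose k := \prod_(i | i != i0) (if i \in s then c i else fine (P (A i))).
have k0 : 0 <= k.
  apply: prodr_ge0 => i _; case: ifP => // _.
  by rewrite fine_ge0.
have g0 w : 0 <= g w by apply: prodr_ge0 => i _; case: ifP.
have mg : measurable_fun [set: T] g.
  rewrite (_ : g = fun w => \prod_i
      (if i != i0 then if i \in s then X i w else \1_(A i) w else 1)); last first.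
    by apply/funext => w; rewrite /g big_mkcond.
  apply: measurable_prod => i _; case: (i != i0) => //; case: (i \in s) => //.
  exact/measurable_indic/(Fm i)/FA.
have step B : measurable B ->
    (\int[P]_(w in X i0 @^-1` B) (g w)%:E = k%:E * P (X i0 @^-1` B))%E.
  move=> mB; pose A' i := if i == i0 then X i0 @^-1` B else A i.
  have FA' i : F i (A' i) by rewrite /A'; case: eqP => // ->; exact: FX.
  have := IH us A' FA'.
  rewrite (bigD1 i0)//= (negbTE i0s) {2}/A' eqxx.
  rewrite [X in (_ * X)%:E](_ : _ = k); last first.
    by apply: eq_bigr => i ii0; rewrite /A' (negbTE ii0).
  rewrite mulrC EFinM Pfin; last exact/(Fm i0)/FX.
  move=> <-; rewrite integral_mkcond; apply: eq_integral => w _.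
  rewrite (bigD1 i0)//= (negbTE i0s) {1}/A' eqxx.
  rewrite [X in (_ * X)%:E](_ : _ = g w); last first.
    by apply: eq_bigr => i ii0; rewrite /A' (negbTE ii0).
  by rewrite patchE indicE; case: ifPn => _; rewrite ?mul1r ?mul0r.
pose X0_mixin := isMeasurableFun.Build _ _ _ _ _ (mX i0).
pose X0' : {RV P >-> R} := HB.pack (X i0) X0_mixin.
pose nu := mscale (NngNum k0) (distribution P X0').
have nuE B : measurable B -> (nu B = \int[P]_(w in X i0 @^-1` B) (g w)%:E)%E.
  by move=> mB; rewrite step.
(* The absolute value is nonnegative on the whole line and is the identity on the values of
   [X i0]. *)
have mabs : measurable_fun [set: R] (fun x : R => `|x|%:E).
  by apply/measurable_EFinP; exact: normr_measurable.
have H := integral_change_of_measure (mX i0) mg g0 nuE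
  (f := fun x => `|x|%:E) (fun x => normr_ge0 x) mabs.
rewrite ge0_integral_mscale// ge0_integral_distribution// in H.
have X0c : (\int[P]_w (((fun x : R => `|x|%:E) \o X0') w) = (c i0)%:E)%E.
  by rewrite -Xc; apply: eq_integral => w _; rewrite /= ger0_norm.
rewrite X0c in H.
transitivity (\int[P]_w (`|X i0 w|%:E * (g w)%:E))%E.
  apply: eq_integral => w _; rewrite (bigD1 i0)//= inE eqxx/= -EFinM ger0_norm//.
  by congr (_ * _)%:E; apply: eq_bigr => i ii0; rewrite inE (negbTE ii0).
rewrite -H -EFinM (bigD1 i0)//= inE eqxx/= mulrC; congr (_ * _)%:E.
by apply: eq_bigr => i ii0; rewrite inE (negbTE ii0).
Qed.

End independence.

(** * Gaussian vectors *)

Section dot_product.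
Context {R : realType} {n : nat}.
Implicit Types u v : 'rV[R]_n.

Definition dotv u v : R := \sum_i u 0 i * v 0 i.

Lemma dotvC u v : dotv u v = dotv v u.
Proof. by apply: eq_bigr => i _; rewrite mulrC. Qed.

Lemma dotvDr u v w : dotv u (v + w) = dotv u v + dotv u w.
Proof. by rewrite -big_split; apply: eq_bigr => i _; rewrite mxE mulrDr. Qed.

Lemma dotvZr a u v : dotv u (a *: v) = a * dotv u v.
Proof. by rewrite mulr_sumr; apply: eq_bigr => i _; rewrite mxE mulrCA. Qed.

Lemma dotvNr u v : dotv u (- v) = - dotv u v.
Proof. by rewrite -scaleN1r dotvZr mulN1r. Qed.

Lemma dotvBr u v w : dotv u (v - w) = dotv u v - dotv u w.
Proof. by rewrite dotvDr dotvNr. Qed.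

Lemma dotvDl u v w : dotv (v + w) u = dotv v u + dotv w u.
Proof. by rewrite !(dotvC _ u) dotvDr. Qed.

Lemma dotvZl a u v : dotv (a *: v) u = a * dotv v u.
Proof. by rewrite !(dotvC _ u) dotvZr. Qed.

Lemma dotvNl u v : dotv (- v) u = - dotv v u.
Proof. by rewrite !(dotvC _ u) dotvNr. Qed.

Lemma dotvBl u v w : dotv (v - w) u = dotv v u - dotv w u.
Proof. by rewrite !(dotvC _ u) dotvBr. Qed.

Lemma dotv0 u : dotv u 0 = 0.
Proof. by rewrite -(scale0r 0) dotvZr mul0r. Qed.

Lemma dotv_sumr (I : Type) (s : seq I) (Q : pred I) u (f : I -> 'rV[R]_n) :
  dotv u (\sum_(i <- s | Q i) f i) = \sum_(i <- s | Q i) dotv u (f i).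
Proof. exact: (big_morph _ (dotvDr u) (dotv0 u)). Qed.

Lemma dotv_suml (I : Type) (s : seq I) (Q : pred I) u (f : I -> 'rV[R]_n) :
  dotv (\sum_(i <- s | Q i) f i) u = \sum_(i <- s | Q i) dotv (f i) u.
Proof. by rewrite dotvC dotv_sumr; apply: eq_bigr => i _; rewrite dotvC. Qed.

Lemma dotv_ge0 v : 0 <= dotv v v.
Proof. by apply: sumr_ge0 => i _; rewrite -expr2 sqr_ge0. Qed.

Lemma sqr_enorm v : enorm v ^+ 2 = dotv v v.
Proof.
rewrite /enorm (_ : \sum_(i < n) _ = dotv v v).
  by rewrite sqr_sqrtr// dotv_ge0.
by apply: eq_bigr => i _; rewrite expr2.
Qed.

Lemma enorm_ge0 v : 0 <= enorm v.
Proof. exact: sqrtr_ge0. Qed.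

Lemma dotv_le u v : dotv u v <= enorm u * enorm v.
Proof.
have [v0|v0] := eqVneq (dotv v v) 0.
  have vi i : v 0 i = 0.
    apply/eqP; rewrite -sqrf_eq0 expr2; apply/eqP; move: i.
    suff: forall i, true -> v 0 i * v 0 i = 0 by move=> H' i; exact: H'.
    by apply: psumr_eq0P => // i _; rewrite -expr2 sqr_ge0.
  rewrite /dotv big1 ?mulr_ge0 ?enorm_ge0// => i _.
  by rewrite vi mulr0.
have vv : 0 < dotv v v by rewrite lt_neqAle eq_sym v0 dotv_ge0.
rewrite (le_trans (ler_norm _))// -(@ler_pXn2r _ 2)// ?nnegrE ?mulr_ge0 ?enorm_ge0//.
rewrite exprMn !sqr_enorm real_normK ?num_real//.
(* The squared norm of this vector is [dotv v v] times the Cauchy-Schwarz defect. *)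
have := dotv_ge0 (dotv v v *: u - dotv u v *: v).
rewrite dotvBl !dotvBr !dotvZl !dotvZr (dotvC v u).
have -> : dotv v v * (dotv v v * dotv u u) - dotv v v * (dotv u v * dotv u v)
  - (dotv u v * (dotv v v * dotv u v) - dotv u v * (dotv u v * dotv v v))
  = dotv v v * (dotv u u * dotv v v - dotv u v ^+ 2) by ring.
by rewrite pmulr_rge0// subr_ge0.
Qed.

Lemma enormN v : enorm (- v) = enorm v.
Proof. by congr Num.sqrt; apply: eq_bigr => i _; rewrite mxE sqrrN. Qed.

Lemma enormZ a v : enorm (a *: v) = `|a| * enorm v.
Proof.
rewrite /enorm -sqrtr_sqr -sqrtrM ?sqr_ge0//; congr Num.sqrt.
by rewrite mulr_sumr; apply: eq_bigr => i _; rewrite mxE exprMn.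
Qed.

Lemma enorm0 : enorm (0 : 'rV[R]_n) = 0.
Proof. by rewrite -(scale0r 0) enormZ normr0 mul0r. Qed.

Lemma enorm_leD u v : enorm (u + v) <= enorm u + enorm v.
Proof.
rewrite -(@ler_pXn2r _ 2)// ?nnegrE ?addr_ge0 ?enorm_ge0//.
rewrite sqrrD !sqr_enorm dotvDl !dotvDr (dotvC v u).
by have := dotv_le u v; nra.
Qed.

Lemma enorm_sum_le (I : Type) (s : seq I) (Q : pred I) (f : I -> 'rV[R]_n) :
  enorm (\sum_(i <- s | Q i) f i) <= \sum_(i <- s | Q i) enorm (f i).
Proof.
elim/big_ind2 : _ => [|x u y v ux vy|//]; first by rewrite enorm0.
by rewrite (le_trans (enorm_leD _ _))// lerD.
Qed.

End dot_product.

Section gaussian_vectors.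
Context d (T : measurableType d) (R : realType) (P : probability T R).
Local Open Scope ereal_scope.

Lemma integral_std_normal (X : T -> R) (f : R -> R) :
  measurable_fun [set: T] X ->
  (forall B, measurable B -> P (X @^-1` B) = normal_prob 0 1 B) ->
  (forall x, (0 <= f x)%R) -> measurable_fun [set: R] f ->
  \int[P]_w (f (X w))%:E = \int[normal_prob 0 1]_x (f x)%:E.
Proof.
move=> mX PX f0 mf.
rewrite (@integral_change_of_measure _ _ _ _ _ P (normal_prob 0 1) X (cst 1%R))//=.
- by apply: eq_integral => w _; rewrite mule1.
- move=> B mB; have mXB : measurable (X @^-1` B).
    by rewrite -[X in measurable X]setTI; exact: mX.
  by rewrite (integral_cst P mXB 1) mul1e; apply/esym/PX.
- exact/measurable_EFinP.
Qed.

Lemma integral_gaussian_prod n (X : T -> 'rV[R]_n) (f : 'I_n -> R -> R) :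
  std_gaussian_vector P X -> (forall i x, (0 <= f i x)%R) ->
  (forall i, measurable_fun [set: R] (f i)) ->
  (forall i, \int[normal_prob 0 1]_x (f i x)%:E < +oo) ->
  \int[P]_w (\prod_i f i (X w 0%R i))%:E =
  (\prod_i fine (\int[normal_prob 0 1]_x (f i x)%:E))%:E.
Proof.
move=> [mX PX indep] f0 mf ffin.
apply: (integral_prod_independent indep).
- by move=> i A [B mB <-]; exact: mX.
- move=> i B mB; exists (f i @^-1` B); last by rewrite setTI.
  by rewrite -[X in measurable X]setTI; exact: mf.
- by move=> i w; exact: f0.
- move=> i; rewrite fineK; last first.
    by rewrite ge0_fin_numE//; apply: integral_ge0 => x _; rewrite lee_fin.
  by apply: (integral_std_normal (X := coordinate X i)) => //; exact: PX.
Qed.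

Lemma integral_gaussian_expR n (X : T -> 'rV[R]_n) (v : 'rV[R]_n) :
  std_gaussian_vector P X ->
  \int[P]_w (expR (dotv v (X w)))%:E = (expR (dotv v v / 2))%:E.
Proof.
move=> gX.
rewrite (eq_integral (fun w => (\prod_(i < n) expR (v 0%R i * X w 0%R i))%:E)); last first.
  by move=> w _; rewrite -expR_sum.
rewrite (@integral_gaussian_prod n X (fun i x => expR (v 0%R i * x)))//.
- under eq_bigr do rewrite integral_normal_expR/=.
  rewrite -expR_sum /dotv mulr_suml; congr (expR _)%:E.
- by move=> i; apply: measurableT_comp => //; exact: measurable_funM.
- by move=> i; rewrite integral_normal_expR ltry.
Qed.

Lemma integral_gaussian_expR_sqr n (X : T -> 'rV[R]_n) (s : R) :
  std_gaussian_vector P X -> (0 <= s <= 1 / 4)%R ->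
  \int[P]_w (expR (s * dotv (X w) (X w)))%:E <= (expR (2 * s * n%:R))%:E.
Proof.
move=> gX s01.
have fin := integral_normal_expR_sqr s01.
rewrite (eq_integral (fun w => (\prod_(i < n) expR (s * X w 0%R i ^+ 2))%:E)); last first.
  move=> w _; rewrite -expR_sum /dotv mulr_sumr; congr (expR _)%:E.
rewrite (@integral_gaussian_prod n X (fun i x => expR (s * x ^+ 2)))//.
- rewrite prodr_const card_ord lee_fin mulrC expRM_natl lerXn2r// ?nnegrE ?expR_ge0 ?fine_ge0//.
    by apply: integral_ge0 => x _; rewrite lee_fin expR_ge0.
  rewrite -lee_fin fineK// ge0_fin_numE ?(le_lt_trans fin) ?ltry//.
  by apply: integral_ge0 => x _; rewrite lee_fin expR_ge0.
- move=> i; apply: measurableT_comp => //; apply: measurable_funM => //.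
- by move=> i; rewrite (le_lt_trans fin) ?ltry.
Qed.

End gaussian_vectors.

Section generated_sigma_algebra.
Context d (T : measurableType d) (R : realType) (n : nat) (X : T -> 'rV[R]_n).

Let G := \big[setU/set0]_(i < n) preimage_set_system [set: T] (coordinate X i) measurable.

Lemma coordinate_g_sigma_preimage i (B : set R) : measurable B ->
  g_sigma_preimage (coordinate X) (coordinate X i @^-1` B).
Proof.
move=> mB; apply: sub_gen_smallest.
rewrite (bigD1 i)//=; left; exists B => //; exact: setTI.
Qed.

Lemma g_sigma_preimage_sub : (forall i, measurable_fun [set: T] (coordinate X i)) ->
  forall A, g_sigma_preimage (coordinate X) A -> measurable A.
Proof.
move=> mX; apply: smallest_sub; first exact: sigma_algebra_measurable.
move=> A; elim/big_ind : _ => [//|U V IU IV [/IU|/IV]//|i _ [B mB <-]].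
exact: mX.
Qed.

(** Independence of vectors speaks of generated sigma-algebras, so measurability is proved on [T]
    re-equipped with the one generated by [X]. *)
Lemma expR_dotv_g_sigma_preimage v (B : set R) : measurable B ->
  g_sigma_preimage (coordinate X) ((fun w => expR (dotv v (X w))) @^-1` B).
Proof.
move=> mB.
have m : measurable_fun [set: g_sigma_algebraType G]
    (fun w : g_sigma_algebraType G => expR (dotv v (X w))).
  apply: measurableT_comp => //; apply: measurable_sum => i.
  apply: measurable_funM => //.
  by move=> _ C mC; rewrite setTI; exact: coordinate_g_sigma_preimage.
by have := m measurableT B mB; rewrite setTI.
Qed.

Lemma g_sigma_preimageT : g_sigma_preimage (coordinate X) [set: T].
Proof. exact: (@measurableT _ (g_sigma_algebraType G)). Qed.

Lemma g_sigma_preimageC A : g_sigma_preimage (coordinate X) A ->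
  g_sigma_preimage (coordinate X) (~` A).
Proof. exact: (@measurableC _ (g_sigma_algebraType G)). Qed.

Lemma g_sigma_preimage_bigcap (I : finType) (A : I -> set T) :
  (forall i, g_sigma_preimage (coordinate X) (A i)) ->
  g_sigma_preimage (coordinate X) (\bigcap_i A i).
Proof.
move=> GA; apply: (@fin_bigcap_measurable _ (g_sigma_algebraType G)) => //.
by move=> i _; exact: GA.
Qed.

End generated_sigma_algebra.

Section independent_gaussians.
Context d (T : measurableType d) (R : realType) (P : probability T R).
Variables (I : finType) (n : nat) (X : I -> T -> 'rV[R]_n).
Hypothesis gX : forall i, std_gaussian_vector P (X i).
Hypothesis indepX : independent_vectors P X.
Local Open Scope ereal_scope.

Lemma measurable_dotv v i : measurable_fun [set: T] (fun w => dotv v (X i w)).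
Proof.
have [mX _ _] := gX i; apply: measurable_sum => l; apply: measurable_funM => //.
exact: mX.
Qed.

Lemma integral_gaussian_vectors_expR (v : I -> 'rV[R]_n) :
  \int[P]_w (expR (\sum_i dotv (v i) (X i w)))%:E =
  (expR (\sum_i dotv (v i) (v i) / 2))%:E.
Proof.
rewrite (eq_integral (fun w => (\prod_i expR (dotv (v i) (X i w)))%:E)); last first.
  by move=> w _; rewrite expR_sum.
rewrite (integral_prod_independent (c := fun i => expR (dotv (v i) (v i) / 2)) indepX).
- by rewrite expR_sum.
- by move=> i; have [mX _ _] := gX i; exact: g_sigma_preimage_sub.
- by move=> i B; exact: expR_dotv_g_sigma_preimage.
- by move=> i w; exact: expR_ge0.
- by move=> i; exact: integral_gaussian_expR.
Qed.

(** Keeping an arbitrary event of [X j] as one factor expresses conditioning on [X j];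
    [gaussian_cross_expR] rests on this. *)
Lemma integral_gaussian_vectors_indic (j : I) (A : set T) (v : I -> 'rV[R]_n) :
  g_sigma_preimage (coordinate (X j)) A ->
  \int[P]_w (\1_A w * expR (\sum_(i | i != j) dotv (v i) (X i w)))%:E =
  P A * (expR (\sum_(i | i != j) dotv (v i) (v i) / 2))%:E.
Proof.
move=> FA; have mA : measurable A.
  by have [mX _ _] := gX j; exact: g_sigma_preimage_sub FA.
pose Y i w := if i == j then \1_A w else expR (dotv (v i) (X i w)).
rewrite (eq_integral (fun w => (\prod_i Y i w)%:E)); last first.
  move=> w _; rewrite expR_sum [in RHS](bigD1 j)//= /Y eqxx; congr (_ * _)%:E.
  by apply: eq_bigr => i /negbTE ->.
pose c i := if i == j then fine (P A) else expR (dotv (v i) (v i) / 2).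
rewrite (integral_prod_independent (c := c) indepX).
- rewrite expR_sum [in LHS](bigD1 j)//= /c eqxx EFinM fineK ?fin_num_measure//.
  by congr (_ * _%:E); apply: eq_bigr => i /negbTE ->.
- by move=> i; have [mX _ _] := gX i; exact: g_sigma_preimage_sub.
- move=> i B mB; rewrite /Y; case: eqP => [->|_]; last exact: expR_dotv_g_sigma_preimage.
  rewrite preimage_indic; case: ifPn => _; case: ifPn => _ //.
  + exact: g_sigma_preimageT.
  + exact: g_sigma_preimageC.
  + by rewrite -setCT; apply: g_sigma_preimageC; exact: g_sigma_preimageT.
- by move=> i w; rewrite /Y; case: eqP => _; rewrite ?expR_ge0.
- move=> i; rewrite /Y /c; case: eqP => _; last exact: integral_gaussian_expR.
  by rewrite integral_indic// setIT fineK// fin_num_measure.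
Qed.

End independent_gaussians.

(** * Quadratic and bilinear Gaussian forms *)

Section subgaussian_square.
Context d (T : measurableType d) (R : realType) (P : probability T R).
Variables (I : finType) (a : I -> T -> R) (s : R).
Hypothesis ma : forall l, measurable_fun [set: T] (a l).
Hypothesis s01 : 0 <= s <= 1 / 4.
Local Open Scope ereal_scope.

(* Each square is linearized by exp (s x^2) = E exp (sqrt (2 s) x g) with g a
   standard normal variable, and the expectations are exchanged by Tonelli. *)
Lemma integral_expR_sum_sqr :
  (forall t : I -> R, \int[P]_w (expR (\sum_l t l * a l w))%:E <=
     (expR (\sum_l t l ^+ 2 / 2))%:E) ->
  \int[P]_w (expR (s * \sum_l a l w ^+ 2))%:E <= (expR (2 * s * #|I|%:R))%:E.
Proof.
move=> subG.
(* [L] lists the coordinates already turned into squares. The others keep arbitrary linear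
   coefficients [t], so that the next one can receive a random coefficient. *)
suff H (L : seq I) : uniq L -> forall t : I -> R,
    \int[P]_w (expR (\sum_l (if l \in L then s * a l w ^+ 2 else t l * a l w)))%:E
    <= (expR (\sum_l (if l \in L then 2 * s else t l ^+ 2 / 2)))%:E.
  have := H (enum I) (enum_uniq _) (fun=> 0%R).
  have -> : (\sum_l (if l \in enum I then 2 * s else 0 ^+ 2 / 2) = 2 * s * #|I|%:R)%R.
    rewrite (eq_bigr (fun=> 2 * s))%R => [|l _]; last by rewrite mem_enum.
    by rewrite sumr_const mulr_natr.
  rewrite (eq_integral (fun w => (expR (s * \sum_l a l w ^+ 2))%:E))// => w _.
  congr (expR _)%:E; rewrite mulr_sumr; apply: eq_bigr => l _.
  by rewrite mem_enum.
elim: L => [_ t|l0 L IH /= /andP[l0L uL] t]; first exact: subG.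
have [s0 s1] := andP s01.
pose r := Num.sqrt (2 * s).
have r2 : (r ^+ 2 = 2 * s)%R by rewrite sqr_sqrtr// mulr_ge0.
pose rest w : R := (\sum_(l | l != l0) (if l \in L then s * a l w ^+ 2 else t l * a l w))%R.
pose C : R := (\sum_(l | l != l0) (if l \in L then 2 * s else t l ^+ 2 / 2))%R.
have mrest : measurable_fun [set: T] rest.
  rewrite (_ : rest = fun w => \sum_l if l != l0 then
      (if l \in L then s * a l w ^+ 2 else t l * a l w) else 0)%R; last first.
    by apply/funext => w; rewrite /rest big_mkcond.
  apply: measurable_sum => l; case: (l != l0) => //; case: (l \in L).
    by apply: measurable_funM => //; exact: measurable_funX.
  exact: measurable_funM.
(* [z.2] is the auxiliary normal variable g; since r^2 = 2 s, integrating it out turns exp (r g a)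
   into exp (s a^2). *)
pose f (z : T * R) := (expR (rest z.1 + r * z.2 * a l0 z.1))%:E.
have mf : measurable_fun [set: T * R] f.
  apply/measurable_EFinP; apply: measurableT_comp => //; apply: measurable_funD.
    by apply: measurableT_comp => //.
  apply: measurable_funM; first by apply: measurable_funM.
  by apply: measurableT_comp => //.
have f0 z : 0 <= f z by rewrite lee_fin expR_ge0.
rewrite (eq_integral (fun w => \int[normal_prob 0 1]_g f (w, g))); last first.
  move=> w _; rewrite (bigD1 l0)//= inE eqxx/= /f/=.
  transitivity (\int[normal_prob 0 1]_g
      ((expR (rest w))%:E * (expR ((r * a l0 w) * g))%:E)); last first.
    by apply: eq_integral => g _; rewrite -EFinM -expRD; congr (expR (_ + _))%:E; ring.
  rewrite ge0_integralZl//; last first.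
    apply/measurable_EFinP; apply: measurableT_comp => //; exact: measurable_funM.
  rewrite integral_normal_expR -EFinM -expRD exprMn r2; congr (expR _)%:E.
  rewrite addrC; congr (_ + _)%R; last by field.
  by apply: eq_bigr => l ll0; rewrite inE (negbTE ll0).
have swap := fubini_tonelli (m1 := P) (m2 := normal_prob 0 1) f mf f0.
rewrite [leLHS]swap.
rewrite [leRHS](_ : _ = (expR C)%:E * (expR (2 * s))%:E); last first.
  rewrite -EFinM -expRD; congr (expR _)%:E.
  rewrite (bigD1 l0)//= inE eqxx/= addrC; congr (_ + _)%R.
  by apply: eq_bigr => l ll0; rewrite inE (negbTE ll0).
apply: (@le_trans _ _ (\int[normal_prob 0 1]_g ((expR C)%:E * (expR (s * g ^+ 2))%:E))); last first.
  rewrite ge0_integralZl//; last first.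
    apply/measurable_EFinP; apply: measurableT_comp => //; apply: measurable_funM => //.
  by rewrite lee_pmul2l// ?lte_fin ?expR_gt0//; exact: integral_normal_expR_sqr.
apply: ge0_le_integral => //.
- by move=> g _; apply: integral_ge0 => w _.
- exact: measurable_fun_fubini_tonelli_G.
- apply: emeasurable_funM => //; apply/measurable_EFinP; apply: measurableT_comp => //.
  by apply: measurable_funM => //.
(* For frozen g the linear coefficient at [l0] is r g. It contributes exp (r^2 g^2 / 2) = exp (s
   g^2), whose mean over g is at most exp (2 s). *)
- move=> g _; have := IH uL (fun l => if l == l0 then r * g else t l)%R.
  rewrite [in leRHS](bigD1 l0)//= (negbTE l0L) eqxx => H.
  rewrite (eq_integral (fun w => (expR (\sum_l (if l \in L then s * a l w ^+ 2 else
     (if l == l0 then r * g else t l) * a l w)))%:E)); last first.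
    move=> w _; congr (expR _)%:E.
    rewrite [in RHS](bigD1 l0)//= (negbTE l0L) eqxx addrC; congr (_ + _)%R.
    by apply: eq_bigr => l /negbTE ->.
  apply: (le_trans H); rewrite -EFinM -expRD lee_fin ler_expR addrC exprMn r2.
  rewrite (_ : 2 * s * g ^+ 2 / 2 = s * g ^+ 2)%R; last by field.
  by rewrite lerD2r le_eqVlt; apply/orP; left; apply/eqP/eq_bigr => l /negbTE ->.
Qed.

End subgaussian_square.

Section frozen_subgaussian.
Context d (T : measurableType d) (R : realType) (P : probability T R).

Import HBSimple HBNNSimple.

Let nnsfun_approximation (f : R -> R) : measurable_fun [set: R] f ->
  (forall t, 0 <= f t) -> exists q : {nnsfun R >-> R}^nat,
  forall t, q n t @[n --> \oo] --> f t /\ forall n, q n t <= f t.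
Proof.
move=> mf f0; have mE : measurable_fun [set: R] (EFin \o f) by apply/measurable_EFinP.
exists (nnsfun_approx measurableT mE) => t; split.
  have := cvg_nnsfun_approx measurableT mE (fun t _ => f0 t) (x := t) I.
  by move=> /fine_cvgP[].
move=> n; rewrite nnsfun_approxE -lee_fin.
exact: (@le_approx _ _ _ setT (EFin \o f) n t (fun x _ => f0 x)).
Qed.

(** Positive and negative parts are approximated separately. Domination by the absolute value keeps
    the sums of squares of the approximations below the original one, so a limit is taken on one
    side of the inequality only. *)
Lemma sfun_approximation_id : exists q : {sfun R >-> R}^nat,
  forall t, q n t @[n --> \oo] --> t /\ forall n, `|q n t| <= `|t|.
Proof.
have [fp cp] : exists q : {nnsfun R >-> R}^nat,
    forall t, q n t @[n --> \oo] --> Num.max t 0 /\ forall n, q n t <= Num.max t 0.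
  apply: nnsfun_approximation => [|t]; last by rewrite le_max lexx orbT.
  exact: measurable_maxr.
have [fn cn] : exists q : {nnsfun R >-> R}^nat,
    forall t, q n t @[n --> \oo] --> Num.max (- t) 0 /\ forall n, q n t <= Num.max (- t) 0.
  apply: nnsfun_approximation => [|t]; last by rewrite le_max lexx orbT.
  exact: measurable_maxr.
exists (fun n => fp n \+ cst (-1) \* fn n) => t.
have [[cpt pt] [cnt nt]] := (cp t, cn t); split => [|n] /=.
  rewrite [X in _ --> X](_ : t = Num.max t 0 + (-1) * Num.max (- t) 0); last first.
    case: (leP t 0) => t0; [rewrite max_l ?oppr_ge0// | rewrite max_r ?oppr_le0 ?(ltW t0)//].
      by rewrite mulN1r opprK add0r.
    by rewrite mulr0 addr0.
  by apply: cvgD => //; apply: cvgM => //; exact: cvg_cst.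
have p0 : 0 <= fp n t by []. have n0 : 0 <= fn n t by [].
move: (pt n) (nt n); case: (leP t 0) => t0.
  rewrite max_l ?oppr_ge0// (ler0_norm t0) => p1 n1.
  by rewrite mulN1r ler_norml; lra.
rewrite max_r; last by rewrite oppr_le0 ltW.
rewrite (gtr0_norm t0) => p1 n1.
by rewrite mulN1r ler_norml; lra.
Qed.

Variables (I : finType) (x y : I -> T -> R) (kappa : R).
Hypothesis mx : forall l, measurable_fun [set: T] (x l).
Hypothesis my : forall l, measurable_fun [set: T] (y l).
Hypothesis kappa0 : 0 <= kappa.
Local Open Scope ereal_scope.

(** Factoring a simple function through a finite type lets the joint values of a finite family be
    indexed by a finite function type. *)
Let finite_values (q : {sfun R >-> R}) :
  exists (J : finType) (v : J -> R) (c : R -> J),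
    (forall t, v (c t) = q t) /\
    forall j, measurable [set t | c t = j].
Proof.
have /finite_seqP[r rE] : finite_set (range q) by [].
have qr t : q t \in r by suff : [set` r] (q t) by []; rewrite -rE; exists t.
exists (seq_sub r : finType), (@ssval _ r), (fun t => SeqSub (qr t)); split => // j.
rewrite (_ : [set _ | _] = q @^-1` [set ssval j]); last first.
  by apply/seteqP; split => t /= => [<-//|qj]; apply/val_inj.
exact: measurable_funPTI.
Qed.

(* If y is sub-Gaussian conditionally on x, the deterministic coefficients in its
   moment generating function may be replaced by x; this is exact for simple
   functions of x, and passes to the limit by Fatou's lemma. *)
Lemma integral_expR_sum_prod_le :
  (forall (v : I -> R) (B : I -> set R), (forall l, measurable (B l)) ->
     \int[P]_w (\1_(\bigcap_l (x l @^-1` B l)) w * expR (\sum_l v l * y l w))%:E <=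
     P (\bigcap_l (x l @^-1` B l)) * (expR (kappa * \sum_l v l ^+ 2))%:E) ->
  \int[P]_w (expR (\sum_l x l w * y l w))%:E <=
  \int[P]_w (expR (kappa * \sum_l x l w ^+ 2))%:E.
Proof.
move=> frozen; have [q qP] := sfun_approximation_id.
have mq n : measurable_fun [set: R] (q n) by [].
have mf n : measurable_fun [set: T] (fun w => (expR (\sum_l q n (x l w) * y l w))%:E).
  apply/measurable_EFinP; apply: measurableT_comp => //; apply: measurable_sum => l.
  by apply: measurable_funM => //; apply: measurableT_comp.
have mg : measurable_fun [set: T] (fun w => (expR (kappa * \sum_l x l w ^+ 2))%:E).
  apply/measurable_EFinP; apply: measurableT_comp => //; apply: measurable_funM => //.
  by apply: measurable_sum => l; exact: measurable_funX.
have bnd n : \int[P]_w (expR (\sum_l q n (x l w) * y l w))%:E <=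
    \int[P]_w (expR (kappa * \sum_l x l w ^+ 2))%:E.
  have [J [v [c [cv mc]]]] := finite_values (q n).
  pose V w : {ffun I -> J} := [ffun l => c (x l w)].
  (* These sets partition the space by the joint values of the simple functions; on each of them the
     coefficients are constants and [frozen] applies. *)
  pose A (phi : {ffun I -> J}) := \bigcap_l (x l @^-1` [set t | c t = phi l]).
  have mA phi : measurable (A phi).
    apply: fin_bigcap_measurable => [|l _]; first exact: finite_finset.
    by rewrite -[X in measurable X]setTI; exact: mx.
  have AE phi w : (w \in A phi) = (V w == phi).
    apply/idP/eqP => [|<-]; rewrite inE; last by move=> l _ /=; rewrite ffunE.
    by move=> wA; apply/ffunP => l; rewrite ffunE; exact: wA.
  have split_sum (h : {ffun I -> J} -> R) w : h (V w) = (\sum_phi \1_(A phi) w * h phi)%R.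
    rewrite (bigD1 (V w))//= indicE AE eqxx mul1r big1 ?addr0// => phi phiV.
    by rewrite indicE AE eq_sym (negbTE phiV) mul0r.
  have step1 : \int[P]_w (expR (\sum_l q n (x l w) * y l w))%:E =
      \sum_phi \int[P]_w (\1_(A phi) w * expR (\sum_l v (phi l) * y l w))%:E.
    rewrite -ge0_integral_sum//.
    - apply: eq_integral => w _; rewrite sumEFin; congr (_%:E).
      rewrite -(split_sum (fun phi => expR (\sum_l v (phi l) * y l w)))%R.
      by congr expR; apply: eq_bigr => l _; rewrite ffunE cv.
    - move=> phi; apply/measurable_EFinP; apply: measurable_funM => //.
      apply: measurableT_comp => //; apply: measurable_sum => l.
      exact: measurable_funM.
  rewrite step1.
  apply: (@le_trans _ _ (\sum_phi P (A phi) * (expR (kappa * \sum_l v (phi l) ^+ 2))%:E)).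
    by apply: lee_sum => phi _; exact: frozen.
  rewrite (_ : \sum_phi _ = \int[P]_w (expR (kappa * \sum_l q n (x l w) ^+ 2))%:E).
    apply: ge0_le_integral => //.
    - apply/measurable_EFinP; apply: measurableT_comp => //; apply: measurable_funM => //.
      apply: measurable_sum => l; apply: measurable_funX; exact: measurableT_comp.
    - move=> w _; rewrite lee_fin ler_expR ler_wpM2l// ler_sum// => l _.
      rewrite -(real_normK (num_real (q n _))) -(real_normK (num_real (x l w))).
      rewrite lerXn2r ?nnegrE ?normr_ge0//; have [_] := qP (x l w); exact.
  transitivity (\int[P]_w (\sum_phi (\1_(A phi) w * expR (kappa * \sum_l v (phi l) ^+ 2))%:E)).
    rewrite ge0_integral_sum//.
    - apply: eq_bigr => phi _; under eq_integral do rewrite mulrC EFinM.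
      rewrite ge0_integralZl_EFin ?expR_ge0//.
        by rewrite (integral_indic P measurableT (mA phi)) setIT muleC.
      by apply/measurable_EFinP.
    - move=> phi; apply/measurable_EFinP; exact: measurable_funM.
  apply: eq_integral => w _; rewrite sumEFin; congr (_%:E).
  rewrite -(split_sum (fun phi => expR (kappa * \sum_l v (phi l) ^+ 2)))%R.
  by congr (expR (_ * _)); apply: eq_bigr => l _; rewrite ffunE cv.
rewrite (eq_integral (fun w => limn_einf (fun n => (expR (\sum_l q n (x l w) * y l w))%:E))); last first.
  move=> w _; apply/esym; apply: (cvg_limn_einf_sup _).1.
  apply: cvg_EFin; first exact: nearW.
  apply: continuous_cvg; first exact: continuous_expR.
  apply: cvg_big => [|l _]; first exact: add_continuous.
  apply: cvgM; last exact: cvg_cst.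
  by have [] := qP (x l w).
apply: (le_trans (fatou _ _ _ _)) => //.
rewrite limn_einf_lim; apply: lime_le; first exact: is_cvg_einfs.
apply: nearW => n; apply: le_trans (bnd n).
by apply: ereal_inf_lbound; exists n => /=.
Qed.

End frozen_subgaussian.

Section markov.
Context d (T : measurableType d) (R : realType) (P : probability T R).
Local Open Scope ereal_scope.

Lemma measurable_ge_set (f : T -> R) (a : R) : measurable_fun [set: T] f ->
  measurable [set w | (a <= f w)%R].
Proof.
by move=> mf; rewrite -[X in measurable X]setTI; apply: measurable_fun_le.
Qed.

Lemma markov_ge0 (f : T -> R) (a c : R) : (0 < a)%R ->
  measurable_fun [set: T] f -> (forall w, (0 <= f w)%R) ->
  \int[P]_w (f w)%:E <= c%:E -> P [set w | (a <= f w)%R] <= (c / a)%:E.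
Proof.
move=> a0 mf f0 fc; set A := [set w | _].
have mA : measurable A by exact: measurable_ge_set.
rewrite EFinM lee_pdivlMr// muleC.
apply: le_trans fc.
have <- : \int[P]_w (\1_A w)%:E = P A by rewrite (integral_indic P measurableT mA) setIT.
rewrite -ge0_integralZl//; [|by apply/measurable_EFinP|by rewrite lee_fin ltW].
apply: ge0_le_integral => //.
- by move=> w _; rewrite -EFinM lee_fin mulr_ge0//; exact: ltW.
- apply: emeasurable_funM; first exact: measurable_cst.
  by apply/measurable_EFinP.
- by apply/measurable_EFinP.
move=> w _; rewrite -EFinM lee_fin indicE.
case: (boolP (w \in A)) => [|_]; last by rewrite mulr0.
by rewrite inE mulr1.
Qed.

Lemma chernoff_expR (f : T -> R) (a c : R) : measurable_fun [set: T] f ->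
  \int[P]_w (expR (f w))%:E <= (expR c)%:E ->
  P [set w | (a <= f w)%R] <= (expR (c - a))%:E.
Proof.
move=> mf fc.
rewrite expRD expRN; rewrite (_ : [set w | _] = [set w | expR a <= expR (f w)]%R).
  apply: markov_ge0 => //; first exact: expR_gt0.
  exact: measurableT_comp.
by apply/seteqP; split => w /=; rewrite ler_expR.
Qed.

End markov.

Definition lin_comb (T : Type) (R : realType) (I : finType) (n : nat)
    (X : I -> T -> 'rV[R]_n) (c : I -> R) (w : T) : 'rV[R]_n :=
  \sum_i c i *: X i w.

Section gaussian_combinations.
Context d (T : measurableType d) (R : realType) (P : probability T R).
Variables (I : finType) (n : nat) (X : I -> T -> 'rV[R]_n).
Hypothesis gX : forall i, std_gaussian_vector P (X i).
Hypothesis indepX : independent_vectors P X.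
Local Open Scope ereal_scope.

Lemma measurable_comb (c : I -> R) l :
  measurable_fun [set: T] (fun w => lin_comb X c w 0%R l).
Proof.
rewrite /lin_comb; under eq_fun do rewrite summxE.
apply: measurable_sum => i; under eq_fun do rewrite mxE.
by apply: measurable_funM => //; have [mX _ _] := gX i; exact: mX.
Qed.

Lemma gaussian_comb_expR (c : I -> R) (t : 'rV[R]_n) :
  \int[P]_w (expR (dotv t (lin_comb X c w)))%:E =
  (expR ((\sum_i c i ^+ 2) * dotv t t / 2))%:E.
Proof.
rewrite (eq_integral (fun w => (expR (\sum_i dotv (c i *: t) (X i w)))%:E)); last first.
  move=> w _; rewrite /lin_comb dotv_sumr; congr (expR _)%:E; apply: eq_bigr => i _.
  by rewrite dotvZr dotvZl.
rewrite integral_gaussian_vectors_expR//; congr (expR _)%:E.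
by rewrite !mulr_suml; apply: eq_bigr => i _; rewrite dotvZl dotvZr mulrA expr2.
Qed.

(** By its moment generating function the combination is sub-Gaussian with variance proxy at most 1,
    and this alone controls the exponential moment of its squared norm. *)
Lemma gaussian_comb_expR_sqr (c : I -> R) (s : R) : (\sum_i c i ^+ 2 <= 1)%R ->
  (0 <= s <= 1 / 4)%R ->
  \int[P]_w (expR (s * dotv (lin_comb X c w) (lin_comb X c w)))%:E <=
  (expR (2 * s * n%:R))%:E.
Proof.
move=> c1 s01; rewrite -[in n%:R](card_ord n).
apply: (integral_expR_sum_sqr (P := P) (a := fun l w => lin_comb X c w 0%R l) _ s01).
  by move=> l; exact: measurable_comb.
move=> t; pose v : 'rV[R]_n := \row_l t l.
have tE (u : 'rV[R]_n) : (\sum_l t l * u 0 l = dotv v u)%R by apply: eq_bigr => l _; rewrite mxE.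
rewrite (eq_integral (fun w => (expR (dotv v (lin_comb X c w)))%:E)); last first.
  by move=> w _; rewrite -tE.
rewrite gaussian_comb_expR lee_fin ler_expR.
have -> : (\sum_l t l ^+ 2 / 2 = dotv v v / 2)%R.
  by rewrite mulr_suml; apply: eq_bigr => l _; rewrite !mxE expr2.
by rewrite -mulrA ler_piMl// mulr_ge0 ?dotv_ge0.
Qed.

(** As [c j] is 0, the combination is independent of [X j]. With [X j] frozen, the exponential
    moment is that of k |X j|^2 / 2, where k is the sum of the squares of [c]; the condition b <=
    1/2 puts k / 2 in the range of [integral_gaussian_expR_sqr]. *)
Lemma gaussian_cross_expR (j : I) (c : I -> R) (b : R) : c j = 0%R ->
  (\sum_i c i ^+ 2 <= b)%R -> (b <= 1 / 2)%R ->
  \int[P]_w (expR (dotv (X j w) (lin_comb X c w)))%:E <= (expR (b * n%:R))%:E.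
Proof.
move=> cj cb b2.
have c0 : (0 <= \sum_i c i ^+ 2)%R by apply: sumr_ge0 => i _; exact: sqr_ge0.
set k := (\sum_i c i ^+ 2)%R in cb c0.
have b0 : (0 <= b)%R by exact: le_trans cb.
have mXj l : measurable_fun [set: T] (coordinate (X j) l) by have [+ _ _] := gX j; exact.
apply: (@le_trans _ _ (\int[P]_w (expR (k / 2 * \sum_l coordinate (X j) l w ^+ 2))%:E)).
  apply: (integral_expR_sum_prod_le (x := coordinate (X j)) (y := fun l w => lin_comb X c w 0%R l)).
  - by [].
  - by move=> l; exact: measurable_comb.
  - by rewrite divr_ge0.
  move=> v B mB; set A := \bigcap_l _.
  have FA : g_sigma_preimage (coordinate (X j)) A.
    apply: g_sigma_preimage_bigcap => l; exact: coordinate_g_sigma_preimage.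
  pose u : 'rV[R]_n := \row_l v l.
  have E := integral_gaussian_vectors_indic gX indepX (fun i => c i *: u)%R FA.
  rewrite (eq_integral (fun w => (\1_A w *
      expR (\sum_(i | i != j) dotv (c i *: u) (X i w)))%:E)%R); last first.
    move=> w _; congr (_ * expR _)%:E.
    transitivity (dotv u (lin_comb X c w)).
      by apply: eq_bigr => l _; rewrite mxE.
    rewrite /lin_comb dotv_sumr [LHS](bigD1 j)//= cj scale0r dotv0 add0r.
    by apply: eq_bigr => i _; rewrite dotvZr dotvZl.
  rewrite E; rewrite lee_wpmul2l// lee_fin ler_expR.
  have uu : (dotv u u = \sum_l v l ^+ 2)%R.
    by apply: eq_bigr => l _; rewrite !mxE expr2.
  rewrite -uu [in leRHS]mulrAC mulr_suml mulr_suml [in leRHS](bigD1 j)//= cj expr0n/= !mul0r add0r.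
  by apply: ler_sum => i _; rewrite dotvZl dotvZr mulrA expr2.
apply: (le_trans (integral_gaussian_expR_sqr (s := k / 2) (gX j) _)).
  by rewrite divr_ge0//= ler_pdivrMr//; lra.
by rewrite lee_fin ler_expR ler_wpM2r// mulrC divfK.
Qed.
End gaussian_combinations.

(** * High-probability bounds on the noise *)

Section noise_bound.
Context d (T : measurableType d) (R : realType) (P : probability T R).

Lemma measure_bigU_le (I : Type) (s : seq I) (A : I -> set T) :
  (forall i, measurable (A i)) ->
  (P (\big[setU/set0]_(i <- s) A i) <= \sum_(i <- s) P (A i))%E.
Proof.
move=> mA; elim: s => [|i s IH]; first by rewrite !big_nil measure0.
have ms : measurable (\big[setU/set0]_(j <- s) A j) by exact: bigsetU_measurable.
by rewrite !big_cons; apply: (le_trans (measureU2 _ _ _)) => //; rewrite leeD2l.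
Qed.

Variables (I : finType) (n : nat) (X : I -> T -> 'rV[R]_n).
Hypothesis gX : forall i, std_gaussian_vector P (X i).
Hypothesis indepX : independent_vectors P X.

Lemma measurable_dotv_lin_comb (c e : I -> R) :
  measurable_fun [set: T] (fun w => dotv (lin_comb X c w) (lin_comb X e w)).
Proof.
by apply: measurable_sum => l; apply: measurable_funM; exact: measurable_comb.
Qed.

(* Union bound over the 2^#|I| partial sums, each of which is a rescaled standard
   Gaussian vector. *)
Lemma gaussian_partial_sums_bound : (0 < #|I|)%N ->
  exists2 B : set T, measurable B & (P B <= (#|I|%:R^-1)%:E)%E /\
    forall w, ~ B w -> forall S : {set I},
      enorm (\sum_(i in S) X i w) ^+ 2 <= 8 * (#|I|%:R + n%:R) * #|S|%:R.
Proof.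
move=> I0; set N : R := #|I|%:R.
have N0 : 0 < N by rewrite ltr0n.
pose c (S : {set I}) i : R := if i \in S then (Num.sqrt #|S|%:R)^-1 else 0.
pose f (S : {set I}) w := 1 / 4 * dotv (lin_comb X (c S) w) (lin_comb X (c S) w).
(* The exponential moment of [f S] is at most exp (n / 2), so Chernoff's bound at this level leaves
   at most exp (- 2 N): one factor exp (- N) pays for the 2^N subsets, the other is at most 1 /
   N. *)
pose A S := [set w | 2 * (N + n%:R) <= f S w].
have mf S : measurable_fun [set: T] (f S).
  apply: measurable_funM => //; exact: measurable_dotv_lin_comb.
have mA S : measurable (A S) by exact: measurable_ge_set.
have PA S : (P (A S) <= (expR (- (2 * N)))%:E)%E.
  have c1 : \sum_i c S i ^+ 2 <= 1.
    rewrite (eq_bigr (fun i => if i \in S then #|S|%:R^-1 else 0)); last first.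
      by move=> i _; rewrite /c; case: ifP => _; rewrite ?expr0n// exprVn sqr_sqrtr.
    rewrite -big_mkcond sumr_const/= -[leLHS]mulr_natr.
    by have [->|S0] := eqVneq #|S| 0%N; rewrite ?mulr0// mulVf// pnatr_eq0.
  have H := gaussian_comb_expR_sqr gX indepX c1 (s := 1 / 4).
  apply: (le_trans (chernoff_expR (c := 2 * (1 / 4) * n%:R) _ (mf S) _)).
    by apply: H; apply/andP; split; lra.
  rewrite lee_fin ler_expR; have : 0 <= n%:R :> R by []. lra.
exists (\big[setU/set0]_(S : {set I}) A S); first exact: bigsetU_measurable.
split.
  apply: (le_trans (measure_bigU_le _ mA)).
  apply: (@le_trans _ _ (\sum_(S : {set I}) (expR (- (2 * N)))%:E)%E).
    by apply: lee_sum => S _; exact: PA.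
  rewrite sumEFin lee_fin sumr_const -cardsT -powersetT card_powerset cardsT.
  rewrite -[leLHS]mulr_natr natrX.
  have e1 : 2 ^+ #|I| <= expR N.
    rewrite /N -[in leRHS](mulr1 #|I|%:R) expRM_natl lerXn2r ?nnegrE ?expR_ge0//.
    by have := expR_ge1Dx (1 : R); lra.
  apply: (@le_trans _ _ (expR (- N))).
    apply: (@le_trans _ _ (expR (- (2 * N)) * expR N)).
      by rewrite ler_wpM2l ?expR_ge0.
    by rewrite -expRD ler_expR; lra.
  rewrite expRN lef_pV2 ?posrE ?expR_gt0//.
  by have := expR_ge1Dx N; lra.
move=> w nB S.
have [S0|S0] := eqVneq #|S| 0%N.
  move/eqP: S0; rewrite cards_eq0 => /eqP ->.
  by rewrite big_set0 enorm0 cards0 mulr0 expr0n.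
have fS : f S w < 2 * (N + n%:R).
  rewrite ltNge; apply/negP => H; apply: nB.
  by rewrite (bigD1 S)//=; left.
have S0' : 0 < #|S|%:R :> R by rewrite ltr0n lt0n.
have -> : \sum_(i in S) X i w = Num.sqrt #|S|%:R *: lin_comb X (c S) w.
  rewrite /lin_comb scaler_sumr big_mkcond; apply: eq_bigr => i _.
  rewrite /c; case: ifP => _; last by rewrite scale0r scaler0.
  by rewrite scalerA divff ?scale1r// gt_eqF// sqrtr_gt0.
rewrite enormZ exprMn ger0_norm ?sqrtr_ge0// sqr_sqrtr// mulrC.
rewrite ler_pM2r// sqr_enorm; move: fS; rewrite /f; lra.
Qed.

End noise_bound.

(** * Errors that do not depend on the current labels *)

Section ideal_error.
Context {R : realType} {p k n : nat}.
Variables (dl : R) (theta : 'I_k -> 'rV[R]_n) (zstar : {ffun 'I_p -> 'I_k}).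
Implicit Types (eps : 'I_p -> 'rV[R]_n) (j : 'I_p) (b : 'I_k).

Definition sqgap j b : R := enorm (theta (zstar j) - theta b) ^+ 2.

(* The events on which sample j may be assigned to b by the estimated centers of
   the true clustering, up to slack dl. *)
Definition ideal_error eps j b : bool :=
  [|| (1 - dl) / 2 * sqgap j b <= - dotv (eps j) (theta (zstar j) - theta b),
      dl / 16 * sqgap j b <= - dotv (eps j) (Defs.center eps zstar (zstar j)) |
      dl / 16 * sqgap j b <= dotv (eps j) (Defs.center eps zstar b)].

(** Summing over all wrong labels makes this a function of the noise alone that covers whichever
    label the algorithm picks. *)
Definition ideal_loss eps : R :=
  \sum_j \sum_(b | b != zstar j) sqgap j b * (ideal_error eps j b)%:R.

End ideal_error.

Lemma cluster_sizeE (p k : nat) (z : {ffun 'I_p -> 'I_k}) a :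
  cluster_size z a = #|[set j | z j == a]%SET|.
Proof.
rewrite -sum1_card [RHS]big_mkcond; apply: eq_bigr => j _.
by rewrite finset.in_set; case: eqP.
Qed.

Lemma indic_bool (T : Type) (R : pzRingType) (b : T -> bool) (w : T) :
  \1_[set w | b w] w = (b w)%:R :> R.
Proof.
rewrite indicE; case: (boolP (b w)) => bw; first by rewrite mem_set.
by rewrite memNset//; exact/negP.
Qed.

Section ideal_error_probability.
Context d (T : measurableType d) (R : realType) (P : probability T R).
Context {p k n : nat}.
Variables (eps : 'I_p -> T -> 'rV[R]_n).
Hypothesis geps : forall j, std_gaussian_vector P (eps j).
Hypothesis indep : independent_vectors P eps.
Variables (dl : R) (theta : 'I_k -> 'rV[R]_n) (zstar : {ffun 'I_p -> 'I_k}).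
Hypothesis dl01 : 0 < dl < 1 / 3.
Let N a : R := (cluster_size zstar a)%:R.
Let D j b : R := sqgap theta zstar j b.
Let E w := fun j => eps j w.

Hypothesis N0 : forall a, 0 < N a.
Hypothesis N_large : forall a, (4 / dl) ^+ 2 / N a <= 1 / 2.
Hypothesis N_dim : forall j b, b != zstar j -> forall a, (4 / dl) ^+ 2 / N a * n%:R <= D j b / 8.

Let center_lin_comb (a : 'I_k) w :
  Defs.center (E w) zstar a = lin_comb eps (fun i => if zstar i == a then (N a)^-1 else 0) w.
Proof.
rewrite /Defs.center /lin_comb scaler_sumr big_mkcond; apply: eq_bigr => i _.
by case: eqP; rewrite ?scale0r.
Qed.

Let sum_sqr_le (a : 'I_k) (x : R) (c : 'I_p -> R) :
  (forall i, c i ^+ 2 <= if zstar i == a then x / N a ^+ 2 else 0) ->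
  \sum_i c i ^+ 2 <= x / N a.
Proof.
move=> cx; apply: (le_trans (ler_sum _ (fun i _ => cx i))).
rewrite -big_mkcond sumr_const/= -[leLHS]mulr_natr.
rewrite (_ : #|_| = cluster_size zstar a); last by rewrite cluster_sizeE cardsE.
rewrite -/(N a) expr2 invfM mulrA -[leLHS]mulrA mulVf ?mulr1//.
by rewrite gt_eqF.
Qed.


Let mdot (c : 'I_p -> R) j : measurable_fun [set: T] (fun w => dotv (eps j w) (lin_comb eps c w)).
Proof.
have -> : (fun w => dotv (eps j w) (lin_comb eps c w)) =
    (fun w => dotv (lin_comb eps (fun i => (i == j)%:R) w) (lin_comb eps c w)).
  apply/funext => w; congr dotv; rewrite /lin_comb (bigD1 j)//= eqxx scale1r big1 ?addr0//.
  by move=> i /negbTE ->; rewrite scale0r.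
exact: measurable_dotv_lin_comb.
Qed.

Let mdotl (v : 'rV[R]_n) j : measurable_fun [set: T] (fun w => dotv (eps j w) v).
Proof.
by under eq_fun do rewrite dotvC; exact: measurable_dotv.
Qed.

(** Scaling by 4 / dl raises the level from dl D / 16 to D / 4. The squared coefficients then sum to
    at most (4 / dl)^2 / N a, which [N_large] and [N_dim] keep so small that the moment costs only
    exp (D / 8). *)
Let cross_tail (j : 'I_p) (b a : 'I_k) (c : 'I_p -> R) : b != zstar j -> c j = 0 ->
  (forall i, c i ^+ 2 <= if zstar i == a then (4 / dl) ^+ 2 / N a ^+ 2 else 0) ->
  (P [set w | (4 / dl * (dl / 16 * D j b) <= dotv (eps j w) (lin_comb eps c w))%R] <=
   (expR (- (D j b / 8)))%:E)%E.
Proof.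
move=> bj cj cx.
have H := gaussian_cross_expR geps indep cj (sum_sqr_le cx) (N_large a).
apply: (le_trans (chernoff_expR _ (mdot c j) H)).
rewrite lee_fin ler_expR; have := N_dim bj a.
have -> : 4 / dl * (dl / 16 * D j b) = D j b / 4.
  by field; case/andP: dl01 => /gt_eqF->.
lra.
Qed.

Lemma sqgap_ge0 j b : 0 <= D j b.
Proof. by rewrite /D /sqgap sqr_ge0. Qed.

Lemma measurable_ideal_error j b : measurable [set w | ideal_error dl theta zstar (E w) j b].
Proof.
rewrite (_ : [set w | _] =
  [set w | (1 - dl) / 2 * D j b <= - dotv (eps j w) (theta (zstar j) - theta b)] `|`
  ([set w | dl / 16 * D j b <= - dotv (eps j w) (Defs.center (E w) zstar (zstar j))] `|`
   [set w | dl / 16 * D j b <= dotv (eps j w) (Defs.center (E w) zstar b)])); last first.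
  apply/seteqP; split => w /=; first by move=> /or3P[]; auto.
  by move=> [h|[h|h]]; apply/or3P; [apply: Or31|apply: Or32|apply: Or33].
apply: measurableU; first by apply: measurable_ge_set; apply: measurableT_comp => //; exact: mdotl.
under [X in measurable (X `|` _)]eq_set do rewrite center_lin_comb.
under [X in measurable (_ `|` X)]eq_set do rewrite center_lin_comb.
apply: measurableU; apply: measurable_ge_set; last exact: mdot.
by apply: measurableT_comp => //; exact: mdot.
Qed.

(** For the first alternative, (1 - dl) / 2 is the optimal Chernoff parameter and yields the
    exponent (1 - dl)^2 D / 8. The other two alternatives cost exp (- D / 8), which is no larger. *)
Lemma ideal_error_prob j b : b != zstar j ->
  (P [set w | ideal_error dl theta zstar (E w) j b] <=
   (3 * expR (- ((1 - dl) ^+ 2 * D j b / 8)))%:E)%E.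
Proof.
move=> bj; have [dl0 dl1] := andP dl01.
have D0 := sqgap_ge0 j b.
pose v := theta (zstar j) - theta b.
(* The term of eps j itself in its cluster mean has a favourable sign: c2 omits it. *)
pose c2 i : R := if (zstar i == zstar j) && (i != j) then - (4 / dl / N (zstar j)) else 0.
pose c3 i : R := if zstar i == b then 4 / dl / N b else 0.
pose A1 := [set w | (1 - dl) ^+ 2 / 4 * D j b <= dotv (- ((1 - dl) / 2) *: v) (eps j w)].
pose A2 := [set w | 4 / dl * (dl / 16 * D j b) <= dotv (eps j w) (lin_comb eps c2 w)].
pose A3 := [set w | 4 / dl * (dl / 16 * D j b) <= dotv (eps j w) (lin_comb eps c3 w)].
have l0 : 0 < 4 / dl by rewrite divr_gt0.
have mA1 : measurable A1 by apply: measurable_ge_set; exact: measurable_dotv.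
have mA2 : measurable A2 by apply: measurable_ge_set; exact: mdot.
have mA3 : measurable A3 by apply: measurable_ge_set; exact: mdot.
have sub : [set w | ideal_error dl theta zstar (E w) j b] `<=` A1 `|` (A2 `|` A3).
  move=> w /= /or3P[H|H|H].
  - left; rewrite /A1 /= dotvZl dotvC mulNr -mulrN.
    rewrite (_ : (1 - dl) ^+ 2 / 4 * D j b = (1 - dl) / 2 * ((1 - dl) / 2 * D j b)); last by field.
    by rewrite ler_wpM2l//; lra.
  - right; left; rewrite /A2 /=.
    apply: (@le_trans _ _ (4 / dl * - dotv (E w j) (Defs.center (E w) zstar (zstar j)))).
      by rewrite ler_pM2l.
    rewrite center_lin_comb /lin_comb !dotv_sumr mulrN -mulNr mulr_sumr.
    apply: ler_sum => i _; rewrite /c2 !dotvZr.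
    have [->|ij] := eqVneq i j.
      rewrite eqxx andbF mul0r mulrA mulNr mulNr oppr_le0.
      by rewrite mulr_ge0 ?dotv_ge0// mulr_ge0 ?invr_ge0 ?ltW.
    by rewrite andbT; case: eqP => _; rewrite ?mul0r ?mulr0// mulrA mulNr.
  - right; right; rewrite /A3 /=.
    apply: (@le_trans _ _ (4 / dl * dotv (E w j) (Defs.center (E w) zstar b))).
      by rewrite ler_pM2l.
    rewrite center_lin_comb /lin_comb !dotv_sumr mulr_sumr.
    apply: ler_sum => i _; rewrite /c3 !dotvZr.
    by case: eqP => _; rewrite ?mul0r ?mulr0// mulrA.
apply: (@le_trans _ _ (P (A1 `|` (A2 `|` A3)))).
  by apply: le_measure => //; rewrite ?inE; [exact: measurable_ideal_error|do 2?apply: measurableU].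
have e8 : expR (- (D j b / 8)) <= expR (- ((1 - dl) ^+ 2 * D j b / 8)).
  rewrite ler_expR lerN2 ler_wpM2r// ler_piMl//; nra.
have PA1 : (P A1 <= (expR (- ((1 - dl) ^+ 2 * D j b / 8)))%:E)%E.
  have H : (\int[P]_w (expR (dotv (- ((1 - dl) / 2) *: v) (eps j w)))%:E <=
      (expR ((1 - dl) ^+ 2 * D j b / 8))%:E)%E.
    rewrite integral_gaussian_expR// lee_fin ler_expR dotvZl dotvZr -sqr_enorm.
    by rewrite -/(sqgap theta zstar j b) -/(D j b); lra.
  have mv := measurable_dotv geps (- ((1 - dl) / 2) *: v) j.
  by apply: (le_trans (chernoff_expR _ mv H)); rewrite lee_fin ler_expR; lra.
have PA2 : (P A2 <= (expR (- ((1 - dl) ^+ 2 * D j b / 8)))%:E)%E.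
  apply: le_trans (_ : (_ <= (expR (- (D j b / 8)))%:E)%E) _; last by rewrite lee_fin.
  apply: (cross_tail (a := zstar j) bj).
    by rewrite /c2 !eqxx.
  move=> i; rewrite /c2; case: eqP => _ /=; last by rewrite expr0n.
  case: ifP => _; first by rewrite sqrrN exprMn exprVn.
  by rewrite expr0n divr_ge0 ?sqr_ge0.
have PA3 : (P A3 <= (expR (- ((1 - dl) ^+ 2 * D j b / 8)))%:E)%E.
  apply: le_trans (_ : (_ <= (expR (- (D j b / 8)))%:E)%E) _; last by rewrite lee_fin.
  apply: (cross_tail (a := b) bj).
    by rewrite /c3 eq_sym (negbTE bj).
  move=> i; rewrite /c3; case: eqP => _ /=; last by rewrite expr0n.
  by rewrite exprMn exprVn.
apply: (le_trans (measureU2 _ _ _)) => //; first exact: measurableU.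
rewrite (_ : (3 * _)%:E = (expR (- ((1 - dl) ^+ 2 * D j b / 8)))%:E +
  ((expR (- ((1 - dl) ^+ 2 * D j b / 8)))%:E + (expR (- ((1 - dl) ^+ 2 * D j b / 8)))%:E))%E; last first.
  by rewrite -!EFinD; congr (_%:E); ring.
apply: leeD => //.
by apply: (le_trans (measureU2 _ _ _)) => //; apply: leeD.
Qed.

Lemma measurable_ideal_loss :
  measurable_fun [set: T] (fun w => ideal_loss dl theta zstar (E w)).
Proof.
apply: measurable_sum => j; rewrite (_ : (fun w => _) = (fun w => \sum_b
  (if b != zstar j then sqgap theta zstar j b * (ideal_error dl theta zstar (E w) j b)%:R else 0))); last first.
  by apply/funext => w; rewrite big_mkcond.
apply: measurable_sum => b; case: (b != zstar j) => //.
apply: measurable_funM => //.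
rewrite (_ : (fun w => _) = \1_[set w | ideal_error dl theta zstar (E w) j b]); last first.
  by apply/funext => w; rewrite indic_bool.
exact/measurable_indic/measurable_ideal_error.
Qed.

Lemma ideal_loss_ge0 w : 0 <= ideal_loss dl theta zstar (E w).
Proof. by do 2!(apply: sumr_ge0 => ? _); rewrite mulr_ge0// sqr_ge0. Qed.

(** The loss of 4 dl in the exponent is spent as follows: 2 dl on (1 - dl)^2 >= 1 - 2 dl; one dl to
    absorb the weight [D j b] of an error through x exp (- x) <= 1, which produces 24 / dl; one dl
    to absorb the sum over [k] labels and leave exp (- Dm) to Markov's inequality. *)
Lemma ideal_loss_prob (Dm : R) : (0 < p)%N ->
  (forall j b, b != zstar j -> Dm ^+ 2 <= D j b) ->
  k%:R * (24 / dl) * expR (- (dl * (Dm ^+ 2 / 8))) <= expR (- Dm) ->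
  (P [set w | (p%:R * expR (- ((1 - 4 * dl) * (Dm ^+ 2 / 8))) <=
        ideal_loss dl theta zstar (E w))%R] <= (expR (- Dm))%:E)%E.
Proof.
move=> p0 DmD num; have [dl0 dl1] := andP dl01.
have p0' : 0 < p%:R :> R by rewrite ltr0n.
pose c := 24 / dl * expR (- ((1 - 3 * dl) * (Dm ^+ 2 / 8))).
have term j b : b != zstar j ->
    (\int[P]_w (sqgap theta zstar j b * (ideal_error dl theta zstar (E w) j b)%:R)%:E <= c%:E)%E.
  move=> bj.
  rewrite (eq_integral (fun w => (D j b)%:E * (\1_[set w | ideal_error dl theta zstar (E w) j b] w)%:E)%E); last first.
    by move=> w _; rewrite -EFinM indic_bool.
  have mI := measurable_ideal_error j b.
  rewrite ge0_integralZl//; last 2 first.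
  - by apply/measurable_EFinP.
  - by rewrite lee_fin sqgap_ge0.
  rewrite (integral_indic P measurableT mI) setIT.
  apply: (@le_trans _ _ ((D j b)%:E * (3 * expR (- ((1 - dl) ^+ 2 * D j b / 8)))%:E)%E).
    by rewrite lee_wpmul2l ?lee_fin ?sqgap_ge0// ideal_error_prob.
  rewrite -EFinM lee_fin.
  have h1 : expR (- ((1 - dl) ^+ 2 * D j b / 8)) <=
      expR (- (dl * D j b / 8)) * expR (- ((1 - 3 * dl) * (Dm ^+ 2 / 8))).
    rewrite -expRD ler_expR; have := DmD _ _ bj; have := sqgap_ge0 j b; nra.
  have h2 : dl * D j b / 8 * expR (- (dl * D j b / 8)) <= 1.
    rewrite expRN -ler_pdivlMr ?invr_gt0 ?expR_gt0// invrK mul1r.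
    by have := expR_ge1Dx (dl * D j b / 8); lra.
  have -> : c = 24 / dl * 1 * expR (- ((1 - 3 * dl) * (Dm ^+ 2 / 8))) by rewrite mulr1.
  apply: (@le_trans _ _ (24 / dl * (dl * D j b / 8 * expR (- (dl * D j b / 8))) *
      expR (- ((1 - 3 * dl) * (Dm ^+ 2 / 8))))).
    rewrite (_ : _ * _ * expR (- ((1 - 3 * dl) * (Dm ^+ 2 / 8))) =
      D j b * (3 * (expR (- (dl * D j b / 8)) * expR (- ((1 - 3 * dl) * (Dm ^+ 2 / 8)))))); last first.
      by field; rewrite gt_eqF.
    by rewrite ler_wpM2l ?sqgap_ge0// ler_wpM2l.
  by rewrite ler_wpM2r ?expR_ge0// ler_wpM2l// divr_ge0// ltW.
have mean : (\int[P]_w (ideal_loss dl theta zstar (E w))%:E <= (p%:R * (k%:R * c))%:E)%E.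
  have mt j b : measurable_fun [set: T]
     (fun w => (sqgap theta zstar j b * (ideal_error dl theta zstar (E w) j b)%:R)%:E).
    apply/measurable_EFinP; apply: measurable_funM => //.
    rewrite (_ : (fun w => _) = \1_[set w | ideal_error dl theta zstar (E w) j b]); last first.
      by apply/funext => w; rewrite indic_bool.
    exact/measurable_indic/measurable_ideal_error.
  have t0 j b w : (0 <= (sqgap theta zstar j b * (ideal_error dl theta zstar (E w) j b)%:R)%:E)%E.
    by rewrite lee_fin mulr_ge0// sqr_ge0.
  rewrite (eq_integral (fun w => \sum_j \sum_b (if b != zstar j then
    (sqgap theta zstar j b * (ideal_error dl theta zstar (E w) j b)%:R)%:E else 0))%E); last first.
    move=> w _; rewrite -sumEFin; apply: eq_bigr => j _.
    by rewrite -sumEFin big_mkcond.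
  have c0 : 0 <= c by rewrite mulr_ge0 ?expR_ge0// divr_ge0// ltW.
  rewrite ge0_integral_sum//; last 2 first.
  - by move=> j; apply: emeasurable_sum => b; case: (b != zstar j).
  - by move=> j w _; apply: sume_ge0 => b _; case: (b != zstar j).
  apply: (@le_trans _ _ (\sum_(j < p) (k%:R * c)%:E)%E); last first.
    by rewrite sumEFin lee_fin sumr_const card_ord -[leLHS]mulr_natl.
  apply: lee_sum => j _.
  rewrite ge0_integral_sum//; last 2 first.
  - by move=> b; case: (b != zstar j).
  - by move=> b w _; case: (b != zstar j).
  apply: (@le_trans _ _ (\sum_(b < k) c%:E)%E); last first.
    by rewrite sumEFin lee_fin sumr_const card_ord mulr_natl.
  apply: lee_sum => b _; case: (boolP (b != zstar j)) => bj; first exact: term.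
  by rewrite integral0 lee_fin.
apply: (le_trans (markov_ge0 _ measurable_ideal_loss ideal_loss_ge0 mean)).
  by rewrite mulr_gt0 ?expR_gt0.
rewrite lee_fin ler_pdivrMr ?mulr_gt0 ?expR_gt0//.
rewrite [leRHS]mulrCA ler_pM2l//.
have -> : k%:R * c = k%:R * (24 / dl) * expR (- (dl * (Dm ^+ 2 / 8))) *
    expR (- ((1 - 4 * dl) * (Dm ^+ 2 / 8))).
  rewrite /c -!mulrA -expRD; congr (_ * (_ * (_ * expR _))); lra.
by rewrite ler_wpM2r ?expR_ge0.
Qed.

End ideal_error_probability.

(** * One step of Lloyd's algorithm *)

Lemma sum_by_label (R : realType) (p k : nat) (z : {ffun 'I_p -> 'I_k}) (F : 'I_p -> R) :
  \sum_a \sum_(j | z j == a) F j = \sum_j F j.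
Proof. by rewrite (partition_big z xpredT). Qed.

Lemma enormD4_le (R : realType) (n : nat) (u1 u2 u3 u4 : 'rV[R]_n) :
  enorm (u1 + u2 + u3 + u4) ^+ 2 <=
  4 * (enorm u1 ^+ 2 + enorm u2 ^+ 2 + enorm u3 ^+ 2 + enorm u4 ^+ 2).
Proof.
have h : enorm (u1 + u2 + u3 + u4) <= enorm u1 + enorm u2 + enorm u3 + enorm u4.
  by do 3!(apply: (le_trans (enorm_leD _ _)); rewrite lerD2r).
apply: (@le_trans _ _ ((enorm u1 + enorm u2 + enorm u3 + enorm u4) ^+ 2)).
  by rewrite lerXn2r ?nnegrE ?addr_ge0 ?enorm_ge0.
move: (enorm u1) (enorm u2) (enorm u3) (enorm u4) => a b c e.
have : 0 <= (a - b) ^+ 2 + (a - c) ^+ 2 + (a - e) ^+ 2 + (b - c) ^+ 2 + (b - e) ^+ 2 + (c - e) ^+ 2.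
  by rewrite !addr_ge0 ?sqr_ge0.
by nra.
Qed.

(** Here [e] is the noise, [v] the difference of two true centers, [w] and [w'] the errors of the
    estimated centers of the new and of the true label. The square of [w] has the favourable sign
    and is dropped. *)
Lemma closer_center_gap (R : realType) (n : nat) (v e w w' : 'rV[R]_n) :
  enorm (v + (e - w)) ^+ 2 <= enorm (e - w') ^+ 2 ->
  dotv v v <= - 2 * dotv e v + 2 * dotv v w + 2 * dotv e w - 2 * dotv e w' + dotv w' w'.
Proof.
rewrite !sqr_enorm !dotvDl !dotvDr !dotvNl !dotvNr.
rewrite (dotvC v e) (dotvC w v) (dotvC w e) (dotvC w' e).
by have := dotv_ge0 w; lra.
Qed.

Section lloyd_step_analysis.
Context {R : realType} {p k n : nat}.
Variables (theta : 'I_k -> 'rV[R]_n) (zstar : {ffun 'I_p -> 'I_k}).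
Variables (eps : 'I_p -> 'rV[R]_n) (z z' : {ffun 'I_p -> 'I_k}).
Variables (dl kap Dm K N0 : R).
Let Y j : 'rV[R]_n := theta (zstar j) + eps j.

Hypothesis dl01 : 0 < dl <= 1.
Hypothesis Dm0 : 0 < Dm.
Hypothesis N00 : 0 < N0.
Hypothesis K0 : 0 <= K.
Hypothesis gap : forall a b, a != b -> Dm <= enorm (theta a - theta b).
Hypothesis size_zstar : forall a, N0 <= (cluster_size zstar a)%:R.
Hypothesis noise : forall S : {set 'I_p}, enorm (\sum_(j in S) eps j) ^+ 2 <= K * #|S|%:R.
Hypothesis kap0 : 0 <= kap.
Hypothesis kap_small : 500 * kap <= dl ^+ 2.
Hypothesis K_small : K <= kap * (N0 * Dm ^+ 2).
Hypothesis loss_small : loss theta z zstar <= dl / 72 * (N0 * Dm ^+ 2).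

Let l := loss theta z zstar.
Let mis j : R := (z j != zstar j)%:R.
Let h := \sum_j mis j.
Let dist j := enorm (theta (z j) - theta (zstar j)).
Let la a := \sum_(j | z j == a) dist j ^+ 2.
Let Aset a : {set 'I_p} := [set j | (z j == a) && (zstar j != a)]%SET.
Let Bset a : {set 'I_p} := [set j | (zstar j == a) && (z j != a)]%SET.
Let al a : R := #|Aset a|%:R.
Let be a : R := #|Bset a|%:R.
Let m a : R := (cluster_size z a)%:R.
Let N a : R := (cluster_size zstar a)%:R.

Let dist_ge j : mis j * Dm <= dist j.
Proof.
rewrite /mis /dist; have [->|zj] := eqVneq (z j) (zstar j).
  by rewrite subrr enorm0 mul0r.
by rewrite mul1r gap.
Qed.

Let h_le : h * Dm ^+ 2 <= l.
Proof.
rewrite /h /l /loss mulr_suml; apply: ler_sum => j _.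
have := dist_ge j; rewrite /mis /dist; case: (_ != _); rewrite ?mul1r ?mul0r => H.
  by rewrite lerXn2r ?nnegrE ?enorm_ge0// ltW.
exact: sqr_ge0.
Qed.

Let al_sum : \sum_a al a = h.
Proof.
rewrite /h -(sum_by_label z); apply: eq_bigr => a _.
rewrite /al -sum1_card natr_sum [RHS]big_mkcond [LHS]big_mkcond; apply: eq_bigr => j _.
by rewrite finset.in_set /mis; case: eqP => [->|//]; rewrite eq_sym; case: eqP.
Qed.

Let be_sum : \sum_a be a = h.
Proof.
rewrite /h -(sum_by_label zstar); apply: eq_bigr => a _.
rewrite /be -sum1_card natr_sum [RHS]big_mkcond [LHS]big_mkcond; apply: eq_bigr => j _.
by rewrite finset.in_set /mis; case: eqP => [->|//]; case: eqP.
Qed.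

Let al_le a : al a <= h.
Proof. by rewrite -al_sum (bigD1 a)//= lerDl sumr_ge0. Qed.

Let be_le a : be a <= h.
Proof. by rewrite -be_sum (bigD1 a)//= lerDl sumr_ge0. Qed.

(** Samples carrying label [a] in both labellings cancel. The target group is general because both
    cluster sizes and noise sums are compared this way. *)
Let sum_split (V : zmodType) (F : 'I_p -> V) a :
  \sum_(j | z j == a) F j - \sum_(j | zstar j == a) F j =
  \sum_(j in Aset a) F j - \sum_(j in Bset a) F j.
Proof.
rewrite (bigID (fun j => zstar j == a))/= [X in _ - X](bigID (fun j => z j == a))/=.
rewrite (eq_bigl (fun j => (zstar j == a) && (z j == a))) => [|j]; last by rewrite andbC.
rewrite opprD addrACA subrr add0r; congr (_ - _);
  by apply: eq_bigl => j; rewrite finset.in_set.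
Qed.

Let size_sum (w : {ffun 'I_p -> 'I_k}) a : (cluster_size w a)%:R = \sum_(j | w j == a) 1 :> R.
Proof.
rewrite /cluster_size natr_sum [RHS]big_mkcond; apply: eq_bigr => j _.
by case: eqP.
Qed.

Let m_N a : m a - N a = al a - be a.
Proof.
by rewrite /m /N !size_sum sum_split /al /be -!sum1_card !natr_sum.
Qed.

Let h_small : h <= N0 / 2.
Proof.
have [d0 d1] := andP dl01.
have : h * Dm ^+ 2 <= N0 / 2 * Dm ^+ 2.
  apply: (le_trans h_le); apply: (le_trans loss_small).
  by rewrite mulrA ler_wpM2r ?sqr_ge0// mulrC ler_wpM2l ?(ltW N00)//; lra.
by rewrite ler_pM2r// exprn_gt0.
Qed.

(** At most [h], hence at most N0 / 2, samples leave a true cluster; so no current cluster is empty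
    and the default center 0 never occurs. *)
Let m_ge a : N0 / 2 <= m a.
Proof.
have := m_N a; have := size_zstar a; have := be_le a; have := h_small.
have : 0 <= al a by []. rewrite -/(N a); lra.
Qed.

(** The mean noise of the true cluster is removed because [ideal_error] accounts for it; what
    remains vanishes when the labels are correct. *)
Definition center_drift a : 'rV[R]_n :=
  Defs.center Y z a - theta a - Defs.center eps zstar a.

Let u := center_drift.

Let N_ge a : 0 < N a. Proof. exact: lt_le_trans (size_zstar a). Qed.
Let m_gt a : 0 < m a. Proof. by apply: lt_le_trans (m_ge a); rewrite divr_gt0. Qed.

(** The four sources are the foreign true centers, the noise of the samples wrongly included, that
    of the samples wrongly left out, and the renormalization from [N a] to [m a] samples. *)
Let drift_decomposition a : m a *: u a =
  \sum_(j | z j == a) (theta (zstar j) - theta a) + \sum_(j in Aset a) eps j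
  + (- \sum_(j in Bset a) eps j) + (1 - m a / N a) *: \sum_(j | zstar j == a) eps j.
Proof.
have e1 : m a *: Defs.center Y z a =
    \sum_(j | z j == a) theta (zstar j) + \sum_(j | z j == a) eps j.
  by rewrite /Defs.center scalerA -/(m a) divff ?gt_eqF ?m_gt// scale1r big_split.
have e2 : m a *: theta a = \sum_(j | z j == a) theta a.
  by rewrite sumr_const /m cluster_sizeE cardsE scaler_nat.
have e3 : m a *: Defs.center eps zstar a =
    (m a / N a) *: \sum_(j | zstar j == a) eps j by rewrite /Defs.center scalerA.
rewrite /u /center_drift !scalerBr e1 e2 e3 sumrB -(addrA (_ - _)) -sum_split.
rewrite scalerBl scale1r [RHS]addrA; congr (_ - _).
by rewrite -[RHS]addrA subrK addrAC.
Qed.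

Let drift_bound a : m a ^+ 2 * enorm (u a) ^+ 2 <=
  4 * (la a ^+ 2 / Dm ^+ 2 + 2 * K * (al a + be a)).
Proof.
rewrite -exprMn -[m a]ger0_norm ?ler0n// -enormZ drift_decomposition.
apply: (le_trans (enormD4_le _ _ _ _)); rewrite ler_pM2l//.
(* Each distance is either 0 or at least [Dm], hence at most its square divided by [Dm]. *)
have b1 : enorm (\sum_(j | z j == a) (theta (zstar j) - theta a)) ^+ 2 <= la a ^+ 2 / Dm ^+ 2.
  rewrite -expr_div_n lerXn2r ?nnegrE ?enorm_ge0 ?divr_ge0 ?(ltW Dm0)//.
    by apply: sumr_ge0 => j _; exact: sqr_ge0.
  apply: (le_trans (enorm_sum_le _ _ _)); rewrite /la mulr_suml.
  apply: ler_sum => j /eqP za; rewrite -za -enormN opprB -/(dist j).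
  rewrite ler_pdivlMr// expr2; have := dist_ge j; rewrite /mis.
  have [zj|_] := eqVneq (z j) (zstar j); rewrite ?mul1r => H.
    by rewrite /dist zj subrr enorm0 !mul0r.
  by rewrite ler_wpM2l ?enorm_ge0.
have b2 := noise (Aset a).
have b3 : enorm (- \sum_(j in Bset a) eps j) ^+ 2 <= K * be a by rewrite enormN.
(* The cost is K (al a - be a)^2 / N a, and both [al a] and [be a] are at most [h], hence at most
   [N a]. *)
have b4 : enorm ((1 - m a / N a) *: \sum_(j | zstar j == a) eps j) ^+ 2 <= K * (al a + be a).
  have nz : enorm (\sum_(j | zstar j == a) eps j) ^+ 2 <= K * N a.
    have := noise [set j | zstar j == a]%SET; rewrite -cluster_sizeE.
    by rewrite (eq_bigl (fun j => zstar j == a)) => [//|j]; rewrite finset.in_set.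
  rewrite enormZ exprMn real_normK ?num_real//.
  apply: (@le_trans _ _ ((1 - m a / N a) ^+ 2 * (K * N a))).
    by rewrite ler_wpM2l ?sqr_ge0.
  have -> : (1 - m a / N a) ^+ 2 * (K * N a) = K * ((m a - N a) ^+ 2 / N a).
    by field; rewrite gt_eqF ?N_ge.
  rewrite ler_wpM2l// ler_pdivrMr// m_N.
  have := al_le a; have := be_le a; have := size_zstar a; rewrite -/(N a).
  have : 0 <= al a by []. have : 0 <= be a by []. have := h_small; have := N00.
  move: (al a) (be a) (N a) => x y w N0' h' y0 x0 wN yh xh.
  have xw : x * x <= w * x by rewrite ler_wpM2r//; lra.
  have yw : y * y <= w * y by rewrite ler_wpM2r//; lra.
  have xy : 0 <= x * y by exact: mulr_ge0.
  rewrite (_ : (x - y) ^+ 2 = x * x + y * y - 2 * (x * y)); last by ring.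
  rewrite [leRHS]mulrDl (mulrC x w) (mulrC y w); lra.
move: b1 b2 b3 b4; rewrite -/(al a); lra.
Qed.

(** The term quadratic in the loss becomes linear by spending [loss_small] on one factor; the noise
    term is linear because [h] Dm^2 is at most the loss. Linearity is what makes a contraction
    possible. *)
Let total_drift : \sum_a enorm (u a) ^+ 2 <= 16 / N0 * (dl / 72 + 4 * kap) * l.
Proof.
have l0 : 0 <= l by apply: sumr_ge0 => j _; exact: sqr_ge0.
have la0 a : 0 <= la a by apply: sumr_ge0 => j _; exact: sqr_ge0.
have la_sum : \sum_a la a = l by rewrite /la sum_by_label.
have step a : enorm (u a) ^+ 2 <=
    16 / N0 ^+ 2 * (la a * l / Dm ^+ 2 + 2 * K * (al a + be a)).
  have u0 : 0 <= enorm (u a) ^+ 2 by exact: sqr_ge0.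
  have mm : (N0 / 2) ^+ 2 <= m a ^+ 2.
    by rewrite lerXn2r ?nnegrE ?m_ge// ltW ?divr_gt0.
  have lal : la a ^+ 2 <= la a * l.
    by rewrite expr2 ler_wpM2l// -la_sum (bigD1 a)//= lerDl sumr_ge0.
  have : (N0 / 2) ^+ 2 * enorm (u a) ^+ 2 <= 4 * (la a * l / Dm ^+ 2 + 2 * K * (al a + be a)).
    apply: (@le_trans _ _ (m a ^+ 2 * enorm (u a) ^+ 2)); first by rewrite ler_wpM2r.
    apply: (le_trans (drift_bound a)); rewrite ler_pM2l// lerD2r.
    by rewrite ler_wpM2r// invr_ge0 sqr_ge0.
  rewrite -ler_pdivlMl ?exprn_gt0 ?divr_gt0// => /le_trans; apply.
  by rewrite le_eqVlt; apply/orP; left; apply/eqP; field; rewrite !gt_eqF.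
apply: (le_trans (ler_sum _ (fun a _ => step a))).
rewrite -mulr_sumr big_split/= -mulr_suml -mulr_suml -mulr_sumr big_split/=.
rewrite la_sum al_sum be_sum.
have D20 : 0 < Dm ^+ 2 by rewrite exprn_gt0.
have h1 : l * l / Dm ^+ 2 <= dl / 72 * N0 * l.
  rewrite ler_pdivrMr// (_ : _ * l * _ = dl / 72 * (N0 * Dm ^+ 2) * l); last by ring.
  by rewrite ler_wpM2r.
have h2 : K * h <= kap * N0 * l.
  have h0 : 0 <= h by apply: sumr_ge0.
  apply: (@le_trans _ _ (kap * (N0 * Dm ^+ 2) * h)).
    by rewrite ler_wpM2r.
  rewrite (_ : _ * h = kap * N0 * (h * Dm ^+ 2)); last by ring.
  by rewrite ler_wpM2l// mulr_ge0 ?(ltW N00).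
apply: (@le_trans _ _ (16 / N0 ^+ 2 * (dl / 72 * N0 * l + 4 * (kap * N0 * l)))).
  rewrite ler_wpM2l ?divr_ge0 ?sqr_ge0//; lra.
by rewrite le_eqVlt; apply/orP; left; apply/eqP; field; rewrite !gt_eqF.
Qed.

Let drift_small a : enorm (u a) <= dl / 12 * Dm.
Proof.
have [d0 d1] := andP dl01.
rewrite -(@ler_pXn2r _ 2)// ?nnegrE ?enorm_ge0 ?mulr_ge0 ?divr_ge0 ?(ltW d0) ?(ltW Dm0)//.
apply: (@le_trans _ _ (\sum_a enorm (u a) ^+ 2)).
  by rewrite (bigD1 a)//= lerDl sumr_ge0// => b _; exact: sqr_ge0.
apply: (le_trans total_drift).
have kp := kap0; have ks := kap_small.
have q0 : 0 <= dl / 72 + 4 * kap by lra.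
have q1 : dl / 72 + 4 * kap <= dl / 36.
  have : dl ^+ 2 <= dl by rewrite expr2 ler_piMr// ltW.
  lra.
apply: (@le_trans _ _ (16 / N0 * (dl / 36) * (dl / 72 * (N0 * Dm ^+ 2)))).
  apply: (@le_trans _ _ (16 / N0 * (dl / 36) * l)).
    have l0 : 0 <= l by apply: sumr_ge0 => j _; exact: sqr_ge0.
    by rewrite ler_wpM2r// ler_wpM2l// divr_ge0 ?(ltW N00).
  by rewrite ler_wpM2l// mulr_ge0// divr_ge0 ?(ltW N00) ?(ltW d0).
(* The constant 72 is spent here: 2 / 324 = 1 / 162 lies below (1 / 12)^2. *)
rewrite (_ : _ * (dl / 72 * _) = dl ^+ 2 * (2 / 324) * Dm ^+ 2); last first.
  by field; rewrite gt_eqF.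
have d2 : 0 <= dl ^+ 2 by exact: sqr_ge0.
rewrite exprMn ler_wpM2r ?sqr_ge0// (_ : (dl / 12) ^+ 2 = dl ^+ 2 / 144); last by field.
lra.
Qed.

Let noise_center_small a : enorm (Defs.center eps zstar a) <= dl / 12 * Dm.
Proof.
have [d0 d1] := andP dl01.
rewrite -(@ler_pXn2r _ 2)// ?nnegrE ?enorm_ge0 ?mulr_ge0 ?divr_ge0 ?(ltW d0) ?(ltW Dm0)//.
have nz : enorm (\sum_(j | zstar j == a) eps j) ^+ 2 <= K * N a.
  have := noise [set j | zstar j == a]%SET; rewrite -cluster_sizeE.
  by rewrite (eq_bigl (fun j => zstar j == a)) => [//|j]; rewrite finset.in_set.
rewrite /Defs.center -/(N a) enormZ exprMn real_normK ?num_real//.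
apply: (@le_trans _ _ ((N a)^-1 ^+ 2 * (K * N a))).
  by rewrite ler_wpM2l ?sqr_ge0.
have -> : (N a)^-1 ^+ 2 * (K * N a) = K / N a by field; rewrite gt_eqF ?N_ge.
apply: (@le_trans _ _ (K / N0)).
  by rewrite ler_wpM2l// lef_pV2 ?posrE// size_zstar.
rewrite ler_pdivrMr//; apply: (le_trans K_small); have ks := kap_small; have kp := kap0.
rewrite (_ : (dl / 12 * Dm) ^+ 2 * N0 = dl ^+ 2 / 144 * (N0 * Dm ^+ 2)); last by field.
by rewrite ler_wpM2r ?(mulr_ge0 (ltW N00) (sqr_ge0 _))//; lra.
Qed.

(* The hypotheses on the members of S add up to one for the partial noise sum over
   S, which is at most sqrt (K #|S|), while #|S| Dm ^+ 2 is at most the sum of D2. *)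
Let group_bound (S : {set 'I_p}) (D2 : 'I_p -> R) (v : 'rV[R]_n) :
  (forall j, j \in S -> Dm ^+ 2 <= D2 j) ->
  (forall j, j \in S -> dl / 16 * D2 j <= dotv (eps j) v) ->
  dl ^+ 2 * Dm ^+ 2 * \sum_(j in S) D2 j <= 256 * K * enorm v ^+ 2.
Proof.
move=> D2ge D2dot; have [d0 d1] := andP dl01.
set L := \sum_(j in S) D2 j.
have SL : #|S|%:R * Dm ^+ 2 <= L.
  rewrite -sum1_card natr_sum mulr_suml; apply: ler_sum => j jS.
  by rewrite mul1r D2ge.
have L0 : 0 <= L by apply: le_trans SL; rewrite mulr_ge0 ?sqr_ge0.
have [->|Ln0] := eqVneq L 0; first by rewrite mulr0 mulr_ge0 ?sqr_ge0 ?(mulr_ge0 (ler0n _ _) K0).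
have Lp : 0 < L by rewrite lt_neqAle eq_sym Ln0.
have LV : dl / 16 * L <= enorm (\sum_(j in S) eps j) * enorm v.
  apply: le_trans (dotv_le _ _); rewrite dotv_suml mulr_sumr.
  by apply: ler_sum => j jS; exact: D2dot.
have LV2 : (dl / 16 * L) ^+ 2 <= K * #|S|%:R * enorm v ^+ 2.
  apply: (@le_trans _ _ ((enorm (\sum_(j in S) eps j) * enorm v) ^+ 2)).
    by rewrite lerXn2r ?nnegrE ?mulr_ge0 ?enorm_ge0 ?divr_ge0 ?(ltW d0).
  by rewrite exprMn ler_wpM2r ?sqr_ge0.
rewrite -(ler_pM2r Lp).
have : (dl / 16 * L) ^+ 2 * Dm ^+ 2 <= K * enorm v ^+ 2 * L.
  apply: (@le_trans _ _ (K * #|S|%:R * enorm v ^+ 2 * Dm ^+ 2)).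
    by rewrite ler_wpM2r ?sqr_ge0.
  rewrite (_ : K * _ * _ * _ = K * enorm v ^+ 2 * (#|S|%:R * Dm ^+ 2)); last by ring.
  by rewrite ler_wpM2l// mulr_ge0 ?sqr_ge0.
rewrite (_ : (dl / 16 * L) ^+ 2 * Dm ^+ 2 = (dl ^+ 2 * Dm ^+ 2 * L * L) / 256); last by field.
lra.
Qed.

(** If every alternative fails, [closer_center_gap] bounds D strictly by (1 - dl) D plus dl/3 for 2
    <v, wb>, dl/4 for each of the products of the noise with [wa] and [wb], and dl/6 for |wa|^2, all
    times D. These shares add up to exactly D, a contradiction. *)
Let lloyd_step_error j : lloyd_step Y z z' -> z' j != zstar j ->
  [|| ideal_error dl theta zstar eps j (z' j),
      dl / 16 * sqgap theta zstar j (z' j) <= dotv (eps j) (- u (zstar j)) |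
      dl / 16 * sqgap theta zstar j (z' j) <= dotv (eps j) (u (z' j))].
Proof.
move=> step zj; have [d0 d1] := andP dl01.
set a := zstar j in zj *; set b := z' j in zj *.
pose v := theta a - theta b; set D := sqgap theta zstar j b.
pose wa := Defs.center eps zstar a + u a; pose wb := Defs.center eps zstar b + u b.
have cE c : Defs.center Y z c = theta c + (Defs.center eps zstar c + u c).
  by rewrite /u /center_drift (addrC (Defs.center eps _ _)) subrK addrC subrK.
have wsmall c : enorm (Defs.center eps zstar c + u c) <= dl / 6 * Dm.
  apply: (le_trans (enorm_leD _ _)).
  have := drift_small c; have := noise_center_small c; lra.
have vDm : Dm <= enorm v by apply: gap; rewrite eq_sym.
have DE : D = enorm v ^+ 2 by [].
have := step j a; rewrite !cE.
have -> : Y j - (theta a + (Defs.center eps zstar a + u a)) = eps j - wa.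
  by rewrite /Y -/a opprD addrACA subrr add0r.
have -> : Y j - (theta (z' j) + (Defs.center eps zstar (z' j) + u (z' j))) = v + (eps j - wb).
  by rewrite /Y -/a -/b opprD addrACA.
have vw : dotv v wb <= dl / 6 * D.
  apply: (le_trans (dotv_le _ _)); rewrite DE expr2 mulrCA ler_wpM2l ?enorm_ge0//.
  apply: (le_trans (wsmall b)); rewrite ler_wpM2l//; lra.
have ww : dotv wa wa <= dl / 6 * D.
  rewrite -sqr_enorm; apply: (@le_trans _ _ ((dl / 6 * Dm) ^+ 2)).
    rewrite lerXn2r ?nnegrE ?enorm_ge0 ?mulr_ge0 ?divr_ge0 ?(ltW d0) ?(ltW Dm0)//.
    exact: wsmall.
  rewrite exprMn DE; apply: (@le_trans _ _ (dl / 6 * Dm ^+ 2)).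
    rewrite ler_wpM2r ?sqr_ge0// expr2 ler_piMr ?divr_ge0 ?(ltW d0)//; lra.
  rewrite ler_wpM2l ?divr_ge0 ?(ltW d0)// lerXn2r ?nnegrE ?enorm_ge0 ?(ltW Dm0)//.
move=> /closer_center_gap close; rewrite -sqr_enorm -DE in close.
have da : dotv (eps j) wa = dotv (eps j) (Defs.center eps zstar a) + dotv (eps j) (u a).
  exact: dotvDr.
have db : dotv (eps j) wb = dotv (eps j) (Defs.center eps zstar b) + dotv (eps j) (u b).
  exact: dotvDr.
rewrite da db in close.
apply/or3P; have [E1|E1] := boolP (ideal_error dl theta zstar eps j b); first exact: Or31.
have [E2|E2] := lerP (dl / 16 * D) (dotv (eps j) (- u a)); first exact: Or32.
have [E3|E3] := lerP (dl / 16 * D) (dotv (eps j) (u b)); first exact: Or33.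
move: E1; rewrite /ideal_error !negb_or -!ltNge => /and3P[F1 F2 F3].
move: E2; rewrite dotvNr => E2.
by exfalso; move: F1 F2 F3 close vw ww E2 E3; rewrite -/D -/a -/v; lra.
Qed.

Lemma lloyd_step_contraction : lloyd_step Y z z' ->
  loss theta z' zstar <= ideal_loss dl theta zstar eps + 2^-1 * loss theta z zstar.
Proof.
move=> step; have [d0 d1] := andP dl01.
pose D2 j := sqgap theta zstar j (z' j).
have D2_ge0 j : 0 <= D2 j by exact: sqr_ge0.
pose S1 := [set j | (z' j != zstar j) && (dl / 16 * D2 j <= dotv (eps j) (- u (zstar j)))]%SET.
pose S2 := [set j | (z' j != zstar j) && (dl / 16 * D2 j <= dotv (eps j) (u (z' j)))]%SET.
have D2_ge j : z' j != zstar j -> Dm ^+ 2 <= D2 j.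
  move=> zj; rewrite lerXn2r ?nnegrE ?enorm_ge0 ?(ltW Dm0)//.
  by apply: gap; rewrite eq_sym.
have split_loss : loss theta z' zstar <=
    ideal_loss dl theta zstar eps + (\sum_(j in S1) D2 j + \sum_(j in S2) D2 j).
  rewrite /loss /ideal_loss [\sum_(j in S1) _]big_mkcond [\sum_(j in S2) _]big_mkcond -!big_split/=.
  apply: ler_sum => j _; rewrite -enormN opprB -[leLHS]/(D2 j).
  have i0 : 0 <= \sum_(b | b != zstar j) sqgap theta zstar j b * (ideal_error dl theta zstar eps j b)%:R.
    by apply: sumr_ge0 => b _; rewrite mulr_ge0// sqr_ge0.
  have s0 (S : {set 'I_p}) : 0 <= (if j \in S then D2 j else 0) by case: ifP.
  have [zj|zj] := eqVneq (z' j) (zstar j).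
    have -> : D2 j = 0 by rewrite /D2 /sqgap zj subrr enorm0 expr0n.
    by rewrite !if_same !addr0; exact: i0.
  have /or3P[E|E|E] := lloyd_step_error step zj.
  - rewrite (bigD1 (z' j))//= E mulr1 -/(D2 j) -addrA lerDl !addr_ge0//.
    by apply: sumr_ge0 => b _; rewrite mulr_ge0// sqr_ge0.
  - have -> : j \in S1 by rewrite finset.in_set zj.
    by rewrite addrCA lerDl addr_ge0.
  - have -> : j \in S2 by rewrite finset.in_set zj.
    by rewrite addrA lerDr addr_ge0.
(* [S1] is grouped by true label and [S2] by new label, so that the drift vector is constant on each
   group. *)
have b1 : dl ^+ 2 * Dm ^+ 2 * \sum_(j in S1) D2 j <= 256 * K * \sum_a enorm (u a) ^+ 2.
  rewrite big_mkcond -(sum_by_label zstar) !mulr_sumr; apply: ler_sum => a _.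
  rewrite -enormN; pose S := [set j in S1 | zstar j == a]%SET.
  rewrite -big_mkcondr/= (eq_bigl (fun j => j \in S)); last first.
    by move=> j; rewrite andbC [RHS]finset.in_set.
  apply: group_bound => j; rewrite !finset.in_set => /andP[/andP[zj dj] /eqP ja].
    exact: D2_ge.
  by rewrite -ja.
have b2 : dl ^+ 2 * Dm ^+ 2 * \sum_(j in S2) D2 j <= 256 * K * \sum_a enorm (u a) ^+ 2.
  rewrite big_mkcond -(sum_by_label z') !mulr_sumr; apply: ler_sum => a _.
  pose S := [set j in S2 | z' j == a]%SET.
  rewrite -big_mkcondr/= (eq_bigl (fun j => j \in S)); last first.
    by move=> j; rewrite andbC [RHS]finset.in_set.
  apply: group_bound => j; rewrite !finset.in_set => /andP[/andP[zj dj] /eqP ja].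
    exact: D2_ge.
  by rewrite -ja.
apply: (le_trans split_loss); rewrite lerD2l.
have l0 : 0 <= l by apply: sumr_ge0 => j _; exact: sqr_ge0.
have D0 : 0 < Dm ^+ 2 by rewrite exprn_gt0.
have d20 : 0 < dl ^+ 2 by rewrite exprn_gt0.
rewrite -(ler_pM2l (mulr_gt0 d20 D0)) mulrDr.
apply: (le_trans (lerD b1 b2)).
have kp := kap0; have ks := kap_small.
have q1 : dl / 72 + 4 * kap <= dl / 36.
  have : dl ^+ 2 <= dl by rewrite expr2 ler_piMr// ltW.
  lra.
have total : \sum_a enorm (u a) ^+ 2 <= 16 / N0 * (dl / 36) * l.
  apply: (le_trans total_drift); rewrite ler_wpM2r// ler_wpM2l// divr_ge0// ltW//.
have KT : K * \sum_a enorm (u a) ^+ 2 <= kap * (N0 * Dm ^+ 2) * (16 / N0 * (dl / 36) * l).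
  apply: ler_pM => //; first by apply: sumr_ge0 => a _; exact: sqr_ge0.
rewrite (_ : kap * _ * _ = kap * dl * (4 / 9) * (Dm ^+ 2 * l)) in KT; last first.
  by field; rewrite gt_eqF.
(* The two groups together cost 512 times this quantity, so 1024 yields the factor 1/2; the constant
   500 in [kap_small] is chosen above 4096 / 9. *)
have kd : kap * dl * (4 / 9) <= dl ^+ 2 / 1024.
  have : kap * dl <= kap by rewrite ler_piMr.
  lra.
have := ler_wpM2r (mulr_ge0 (ltW D0) l0) kd.
rewrite -/l; lra.
Qed.

End lloyd_step_analysis.

(** * Iteration and asymptotics *)

Section measurable_labels.
Context d (T : measurableType d) (R : realType) (p k : nat).

Lemma measurable_random_labels (Z : T -> {ffun 'I_p -> 'I_k}) (h : {ffun 'I_p -> 'I_k} -> R) :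
  random_labels Z -> measurable_fun [set: T] (fun w => h (Z w)).
Proof.
move=> mZ; rewrite (_ : (fun w => _) = fun w => \sum_z h z * \1_[set w | Z w = z] w).
  by apply: measurable_sum => z; apply: measurable_funM => //; exact/measurable_indic/mZ.
apply/funext => w; rewrite (bigD1 (Z w))//= indicE mem_set// mulr1 big1 ?addr0// => z zZ.
by rewrite indicE memNset ?mulr0// => /= ZE; move: zZ; rewrite ZE eqxx.
Qed.

End measurable_labels.

Section lloyd_recursion.
Context d (T : measurableType d) (R : realType) (P : probability T R).
Context {p k n : nat}.
Variables (theta : 'I_k -> 'rV[R]_n) (zstar : {ffun 'I_p -> 'I_k}).
Variables (z : nat -> T -> {ffun 'I_p -> 'I_k}).
Hypothesis z_random : forall t, random_labels (z t).

Definition recursion_event (tau : R) : set T :=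
  [set w | forall t : nat, (1 <= t)%N ->
     loss theta (z t w) zstar <= tau + 2^-1 * loss theta (z t.-1 w) zstar].

Lemma measurable_recursion_event tau : measurable (recursion_event tau).
Proof.
rewrite (_ : recursion_event tau = \bigcap_t [set w |
    loss theta (z t.+1 w) zstar <= tau + 2^-1 * loss theta (z t w) zstar]); last first.
  apply/seteqP; split => w /=; first by move=> H t _; exact: H.
  by move=> H [//|t] _; exact: H.
apply: bigcapT_measurable => t; rewrite -[X in measurable X]setTI.
apply: measurable_fun_le => //; first exact: (measurable_random_labels (fun x => loss theta x zstar)).
apply: measurable_funD => //; apply: measurable_funM => //.
exact: (measurable_random_labels (fun x => loss theta x zstar)).
Qed.

Lemma recursion_event_le tau tau' : tau <= tau' ->
  (P (recursion_event tau) <= P (recursion_event tau'))%E.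
Proof.
move=> tt; apply: le_measure; rewrite ?inE; try exact: measurable_recursion_event.
by move=> w H t t1; apply: (le_trans (H t t1)); rewrite lerD2r.
Qed.

Variables (eps Y : 'I_p -> T -> 'rV[R]_n).
Hypothesis eps_gaussian : forall j, std_gaussian_vector P (eps j).
Hypothesis eps_independent : independent_vectors P eps.
Hypothesis Y_model : forall j w, Y j w = theta (zstar j) + eps j w.
Hypothesis z_lloyd : forall t w, lloyd_step (fun j => Y j w) (z t w) (z t.+1 w).
Variables (dl kap Dm N0 eta e : R).
Hypothesis p_gt0 : (0 < p)%N.
Hypothesis dl01 : 0 < dl < 1 / 4.
Hypothesis Dm0 : 0 < Dm.
Hypothesis N00 : 0 < N0.
Hypothesis gap : forall a b, a != b -> Dm <= enorm (theta a - theta b).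
Hypothesis size_zstar : forall a, N0 <= (cluster_size zstar a)%:R.
Hypothesis kap0 : 0 <= kap.
Hypothesis kap_small : 500 * kap <= dl ^+ 2.
Hypothesis noise_small : 8 * (p%:R + n%:R) <= kap * (N0 * Dm ^+ 2).
Hypothesis N0_large : (4 / dl) ^+ 2 / N0 <= 1 / 2.
Hypothesis N0_dim : (4 / dl) ^+ 2 / N0 * n%:R <= Dm ^+ 2 / 8.
Hypothesis k_small : k%:R * (24 / dl) * expR (- (dl * (Dm ^+ 2 / 8))) <= expR (- Dm).
Let tau := p%:R * expR (- ((1 - 4 * dl) * (Dm ^+ 2 / 8))).
Let lmax := dl / 72 * (N0 * Dm ^+ 2).
Hypothesis tau_small : 2 * tau <= lmax.
Hypothesis e_small : e <= lmax.
Hypothesis init : ((1 - eta)%:E <= P [set w | (loss theta (z 0%N w) zstar <= e)%R])%E.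

Lemma recursion_event_prob :
  ((1 - eta - expR (- Dm) - p%:R^-1)%:E <= P (recursion_event tau))%E.
Proof.
have [dl0 dl1] := andP dl01.
have dl3 : 0 < dl < 1 / 3 by apply/andP; split=> //; lra.
have dl11 : 0 < dl <= 1 by apply/andP; split=> //; lra.
pose Ns a : R := (cluster_size zstar a)%:R.
have Ns0 a : 0 < Ns a by exact: lt_le_trans (size_zstar a).
have cN0 : 0 <= (4 / dl) ^+ 2 by exact: sqr_ge0.
have NsN a : (4 / dl) ^+ 2 / Ns a <= (4 / dl) ^+ 2 / N0.
  by rewrite ler_wpM2l// lef_pV2 ?posrE// size_zstar.
have DmD j b : b != zstar j -> Dm ^+ 2 <= sqgap theta zstar j b.
  move=> bj; rewrite lerXn2r ?nnegrE ?enorm_ge0 ?(ltW Dm0)//.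
  by apply: gap; rewrite eq_sym.
have p0 : (0 < #|'I_p|)%N by rewrite card_ord.
have [B1 mB1 [PB1 noise]] := gaussian_partial_sums_bound eps_gaussian eps_independent p0.
rewrite card_ord in PB1 noise.
pose B2 := [set w | tau <= ideal_loss dl theta zstar (fun j => eps j w)].
have Nl a : (4 / dl) ^+ 2 / Ns a <= 1 / 2 by exact: le_trans (NsN a) N0_large.
have Nd j b : b != zstar j -> forall a, (4 / dl) ^+ 2 / Ns a * n%:R <= sqgap theta zstar j b / 8.
  move=> bj a; apply: (@le_trans _ _ ((4 / dl) ^+ 2 / N0 * n%:R)); first by rewrite ler_wpM2r.
  by apply: (le_trans N0_dim); rewrite ler_pM2r ?invr_gt0// DmD.
have PB2 : (P B2 <= (expR (- Dm))%:E)%E.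
  exact: (ideal_loss_prob eps_gaussian eps_independent dl3 Ns0 Nl Nd p_gt0 DmD k_small).
have mB2 : measurable B2.
  apply: measurable_ge_set.
  exact: (measurable_ideal_loss eps_gaussian).
pose I0 := [set w | loss theta (z 0%N w) zstar <= e].
have mI0 : measurable I0.
  rewrite -[X in measurable X]setTI; apply: measurable_fun_le => //.
  exact: (measurable_random_labels (fun x => loss theta x zstar)).
have mG := measurable_recursion_event tau.
have sub : I0 `<=` recursion_event tau `|` (B1 `|` B2).
  move=> w Iw; have [?|nB1] := pselect (B1 w); first by right; left.
  have [?|nB2] := pselect (B2 w); first by right; right.
  left.
  have step t : loss theta (z t w) zstar <= lmax ->
      loss theta (z t.+1 w) zstar <= tau + 2^-1 * loss theta (z t w) zstar.
    move=> lt; have noisew := noise w nB1.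
    have Kw : 0 <= 8 * (p%:R + n%:R) :> R by rewrite mulr_ge0 ?addr_ge0.
    have lw : lloyd_step (fun j => theta (zstar j) + eps j w) (z t w) (z t.+1 w).
      have <- : (fun j => Y j w) = (fun j => theta (zstar j) + eps j w).
        by apply/funext => j; exact: Y_model.
      exact: z_lloyd.
    have := lloyd_step_contraction (eps := fun j => eps j w) dl11 Dm0 N00 Kw gap size_zstar
      noisew kap0 kap_small noise_small lt lw.
    move=> /le_trans; apply; rewrite lerD2r.
    by move/negP: nB2; rewrite -ltNge => /ltW.
  (* The basin is invariant: tau <= lmax / 2, so tau + lmax / 2 <= lmax and the one-step bound
     applies again. *)
  have bound t : loss theta (z t w) zstar <= lmax.
    elim: t => [|t IH]; first exact: le_trans e_small.
    by apply: (le_trans (step t IH)); have := tau_small; lra.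
  by case=> [//|t] _; exact: step.
have : (P I0 <= P (recursion_event tau) + (P B1 + P B2))%E.
  apply: (@le_trans _ _ (P (recursion_event tau `|` (B1 `|` B2)))).
    apply: le_measure; rewrite ?inE//.
    exact: measurableU mG (measurableU _ _ mB1 mB2).
  apply: (le_trans (measureU2 _ _ _)) => //; first exact: measurableU.
  by rewrite leeD2l//; exact: measureU2.
have Gfin : P (recursion_event tau) \is a fin_num by exact: fin_num_measure.
rewrite -(fineK Gfin) => H.
have : ((1 - eta)%:E <= (fine (P (recursion_event tau)))%:E + ((p%:R^-1)%:E + (expR (- Dm))%:E))%E.
  by apply: (le_trans init); apply: (le_trans H); rewrite leeD2l// leeD.
by rewrite -!EFinD !lee_fin; lra.
Qed.

End lloyd_recursion.

(** * From fixed slack to the asymptotic statement *)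

Lemma Delta_min_le (R : realType) (k d : nat) (theta : 'I_k -> 'rV[R]_d) a b :
  a != b -> Delta_min theta <= enorm (theta a - theta b).
Proof.
move=> ab; apply: ge_inf; last by exists (a, b).
by exists 0 => _ [xy _ <-]; exact: enorm_ge0.
Qed.

Lemma Delta_min_ge0 (R : realType) (k d : nat) (theta : 'I_k -> 'rV[R]_d) :
  0 <= Delta_min theta.
Proof.
rewrite /Delta_min; set S := (X in inf X).
have [->|/set0P S0] := eqVneq S set0; first by rewrite inf0.
by apply: lb_le_inf => // _ [xy _ <-]; exact: enorm_ge0.
Qed.

(* A property that is monotone in its slack and holds eventually for every fixed
   slack holds eventually along some vanishing sequence of slacks. *)
Lemma diagonal_slack (R : realType) (Q : nat -> R -> Prop) :
  (forall p x y, x <= y -> Q p x -> Q p y) ->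
  (forall x, 0 < x -> \forall p \near \oo, Q p x) ->
  exists2 delta : nat -> R, delta p @[p --> \oo] --> (0 : R) &
    \forall p \near \oo, Q p (delta p).
Proof.
move=> Qle Qev.
pose S p := [set x | 0 < x /\ Q p x].
have S_lb p : has_lbound (S p) by exists 0 => x [/ltW].
(* The infimum of the admissible slacks may fail to be admissible; the vanishing margin places the
   choice above an admissible one. *)
exists (fun p => inf (S p) + p.+1%:R^-1).
  apply/cvgrPdist_le => x x0.
  have x20 : 0 < x / 2 by rewrite divr_gt0.
  near=> p; rewrite sub0r normrN.
  have Qp : Q p (x / 2) by near: p; exact: Qev.
  have i1 : inf (S p) <= x / 2 by apply: ge_inf.
  have i0 : 0 <= inf (S p).
    by apply: lb_le_inf; [exists (x / 2)|move=> y [/ltW]].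
  have p1 : p.+1%:R^-1 <= x / 2.
    near: p; have := @cvg_harmonic R; move/cvgrPdist_le => /(_ _ x20).
    apply: filterS => p; rewrite sub0r normrN /harmonic/= ger0_norm ?invr_ge0//.
  by rewrite ger0_norm ?addr_ge0 ?invr_ge0// [leRHS]splitr lerD.
have := Qev 1 ltr01; apply: filterS => p Q1.
have Sp : has_inf (S p) by split=> //; exists 1.
have p0 : 0 < p.+1%:R^-1 :> R by rewrite invr_gt0.
have [y [y0 Qy] yl] := inf_adherent p0 Sp.
by apply: Qle Qy; exact: ltW.
Unshelve. all: by end_near. Qed.

(** Both [kk] and 24 / dl are at most exp Dm, while dl Dm >= 32 makes the negative exponent at least
    4 Dm. *)
Lemma exp_beats_linear (R : realType) (dl Dm kk : R) : 0 < dl -> 0 <= kk <= Dm ->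
  (32 / dl) ^+ 2 <= Dm ^+ 2 ->
  kk * (24 / dl) * expR (- (dl * (Dm ^+ 2 / 8))) <= expR (- Dm).
Proof.
move=> dl0 /andP[k0 kD] D2.
have Dm0 : 0 <= Dm by exact: le_trans kD.
have D32 : 32 / dl <= Dm by move: D2; rewrite ler_pXn2r// nnegrE divr_ge0// ltW.
have i0 : 0 < 24 / dl by rewrite divr_gt0.
have ek : kk <= expR Dm by have := expR_ge1Dx Dm; lra.
have ed : 24 / dl <= expR (24 / dl) by have := expR_ge1Dx (24 / dl); lra.
apply: (@le_trans _ _ (expR Dm * expR (24 / dl) * expR (- (dl * (Dm ^+ 2 / 8))))).
  by rewrite ler_wpM2r ?expR_ge0// ler_pM// ltW.
rewrite -!expRD ler_expR.
have dD : 32 <= dl * Dm by move: D32; rewrite ler_pdivrMr// mulrC.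
have h1 : 32 * Dm <= dl * Dm ^+ 2 by rewrite expr2 mulrA ler_wpM2r.
have h2 : 24 / dl <= Dm.
  by apply: le_trans D32; rewrite ler_pM2r ?invr_gt0//; lra.
lra.
Qed.

Lemma lloyd_conditions_near (R : realType) (k d : nat -> nat) (Dm e : nat -> R) (alpha dl kap : R) :
  (forall p, 0 <= Dm p) ->
  Dm p ^+ 2 / ((k p)%:R ^+ 2 * ((k p)%:R * (d p)%:R / p%:R + 1)) @[p --> \oo] --> +oo ->
  p%:R / (k p)%:R @[p --> \oo] --> (+oo : set_system R) ->
  0 < alpha -> 0 < dl < 1 / 5 -> 0 < kap ->
  e p / (p%:R * Dm p ^+ 2 / (k p)%:R) @[p --> \oo] --> (0 : R) ->
  let N0 p := alpha * p%:R / (k p)%:R in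
  \forall p \near \oo,
    [/\ (0 < p)%N, 0 < Dm p & 0 < N0 p] /\
    [/\ 8 * (p%:R + (d p)%:R) <= kap * (N0 p * Dm p ^+ 2),
        (4 / dl) ^+ 2 / N0 p <= 1 / 2 &
        (4 / dl) ^+ 2 / N0 p * (d p)%:R <= Dm p ^+ 2 / 8] /\
    [/\ (k p)%:R * (24 / dl) * expR (- (dl * (Dm p ^+ 2 / 8))) <= expR (- Dm p),
        2 * (p%:R * expR (- ((1 - 4 * dl) * (Dm p ^+ 2 / 8)))) <= dl / 72 * (N0 p * Dm p ^+ 2) &
        e p <= dl / 72 * (N0 p * Dm p ^+ 2)].
Proof.
move=> Dm_ge0 signal ratio a0 /andP[dl0 dl1] kap_gt0 e_small N0.
(* [M1] serves the noise level, [M2] the dimension, [M3] the hypothesis of [exp_beats_linear] and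
   [M4] the smallness of the additive error. *)
pose M1 := 8 / (kap * alpha).
pose M2 := 8 * (4 / dl) ^+ 2 / alpha.
pose M3 := (32 / dl) ^+ 2.
pose M4 := 40 * (144 / (dl * alpha)).
have M1_gt0 : 0 < M1 by rewrite divr_gt0// mulr_gt0.
have M2_gt0 : 0 < M2 by rewrite divr_gt0// mulr_gt0// exprn_gt0// divr_gt0.
have M3_gt0 : 0 < M3 by rewrite exprn_gt0// divr_gt0.
have M4_gt0 : 0 < M4 by rewrite mulr_gt0// divr_gt0// mulr_gt0.
pose M := 1 + M1 + M2 + M3 + M4.
have M1_le : 0 < M1 <= M by apply/andP; split=> //; rewrite /M; clear -M1_gt0 M2_gt0 M3_gt0 M4_gt0; lra.
have M2_le : 0 < M2 <= M by apply/andP; split=> //; rewrite /M; clear -M1_gt0 M2_gt0 M3_gt0 M4_gt0; lra.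
have M3_le : 0 < M3 <= M by apply/andP; split=> //; rewrite /M; clear -M1_gt0 M2_gt0 M3_gt0 M4_gt0; lra.
have M4_le : 0 < M4 <= M by apply/andP; split=> //; rewrite /M; clear -M1_gt0 M2_gt0 M3_gt0 M4_gt0; lra.
have M_ge1 : (0 : R) < 1 <= M by apply/andP; split=> //; rewrite /M; clear -M1_gt0 M2_gt0 M3_gt0 M4_gt0; lra.
have ca0 : 0 < dl / 72 * alpha by rewrite mulr_gt0// divr_gt0.
near=> p.
have p0 : (0 < p)%N by near: p; exists 1%N.
have sM : M <= Dm p ^+ 2 / ((k p)%:R ^+ 2 * ((k p)%:R * (d p)%:R / p%:R + 1)).
  by near: p; move/cvgryPge : signal; exact.
have rM : 2 * (4 / dl) ^+ 2 / alpha <= p%:R / (k p)%:R.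
  by near: p; move/cvgryPge : ratio; exact.
have eM : `|e p / (p%:R * Dm p ^+ 2 / (k p)%:R)| <= dl / 72 * alpha.
  near: p; move/cvgrPdist_le : e_small => /(_ _ ca0); apply: filterS => p.
  by rewrite sub0r normrN.
(* For [k p] equal to 0 the signal ratio would be 0, because 0^-1 = 0. *)
have k0 : (0 < k p)%N.
  rewrite lt0n; apply/eqP => kp0; move: sM; rewrite kp0 expr0n mul0r invr0 mulr0.
  by apply/negP; rewrite -ltNge; case/andP: M_ge1 => _; apply: lt_le_trans.
set P := p%:R in sM rM eM *. set kk := (k p)%:R in sM rM eM *.
set D := Dm p ^+ 2 in sM eM *. set dd := (d p)%:R in sM *.
have P1 : 1 <= P by rewrite ler1n.
have kk1 : 1 <= kk by rewrite ler1n.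
have dd0 : 0 <= dd by [].
have P0 : 0 < P by exact: lt_le_trans P1.
have kk0 : 0 < kk by exact: lt_le_trans kk1.
have den0 : 0 < kk ^+ 2 * (kk * dd / P + 1).
  by rewrite mulr_gt0 ?exprn_gt0// ltr_wpDl// divr_ge0 ?mulr_ge0// ltW.
move: sM; rewrite ler_pdivlMr// => sM.
have MD x : 0 < x <= M -> x * (kk ^+ 2 * (kk * dd / P + 1)) <= D.
  by move=> /andP[x0 xM]; apply: le_trans sM; rewrite ler_wpM2r// ltW.
have q0 : 0 <= kk * dd / P by rewrite divr_ge0 ?mulr_ge0// ltW.
have MDk x : 0 < x <= M -> x * kk ^+ 2 <= D.
  move=> /[dup] xM /MD; apply: le_trans; case/andP: xM => x0 _.
  by rewrite ler_pM2l// ler_peMr ?sqr_ge0// lerDr.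
have kksq : kk <= kk ^+ 2 by rewrite expr2 ler_peMr// ltW.
have MD1 x : 0 < x <= M -> x <= D.
  move=> xM; apply: le_trans (MDk _ xM); case/andP: xM => x0 _.
  by rewrite ler_peMr ?(ltW x0)// (le_trans kk1).
have MDd x : 0 < x <= M -> x * (kk * (dd + P)) <= D * P.
  move=> /[dup] xM /MD xD; case/andP: xM => x0 _.
  apply: (@le_trans _ _ (x * (kk ^+ 2 * (kk * dd / P + 1)) * P)); last by rewrite ler_wpM2r// ltW.
  rewrite -[leRHS]mulrA ler_pM2l// (_ : _ * P = kk ^+ 2 * (kk * dd + P)); last first.
    by field; rewrite gt_eqF.
  apply: ler_pM; rewrite ?(ltW kk0)// ?addr_ge0// ?(ltW P0)//.
  by rewrite lerD2r ler_peMl.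
have D1 : 1 <= D by exact: MD1.
(* The square of [k] in the signal assumption gives k <= Delta_min, which lets the exponential
   absorb the sum over labels. *)
have kD2 : kk ^+ 2 <= D by have := MDk 1 M_ge1; rewrite mul1r.
have D0 : 0 < D by exact: lt_le_trans D1.
have Dmp : 0 < Dm p.
  by rewrite lt_neqAle Dm_ge0 andbT; apply/eqP => H; move: D0; rewrite /D -H expr0n ltxx.
have N00 : 0 < N0 p by rewrite /N0 divr_gt0// mulr_gt0.
split; first by split.
split; split.
- have H := MDd _ M1_le.
  rewrite (_ : kap * (N0 p * D) = kap * alpha / kk * (D * P)); last first.
    by rewrite /N0 -/kk -/P; field; rewrite gt_eqF.
  apply: (@le_trans _ _ (kap * alpha / kk * (M1 * (kk * (dd + P))))); last first.
    by rewrite ler_wpM2l// divr_ge0 ?mulr_ge0 ?ltW.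
  rewrite /M1 le_eqVlt; apply/orP; left; apply/eqP.
  by field; rewrite !gt_eqF.
- rewrite ler_pdivrMr// /N0 -/kk -/P -mulrA.
  apply: (@le_trans _ _ (1 / 2 * (alpha * (2 * (4 / dl) ^+ 2 / alpha)))); last first.
    by rewrite ler_wpM2l// ler_pM2l.
  rewrite le_eqVlt; apply/orP; left; apply/eqP.
  by field; rewrite !gt_eqF.
- have H := MDd _ M2_le.
  have {}H : M2 * (kk * dd) <= D * P.
    by apply: le_trans H; rewrite ler_pM2l// ler_pM2l// lerDl ltW.
  rewrite mulrAC ler_pdivrMr// /N0 -/kk -/P.
  rewrite (_ : D / 8 * _ = alpha / (8 * kk) * (D * P)); last by field; rewrite gt_eqF.
  apply: (@le_trans _ _ (alpha / (8 * kk) * (M2 * (kk * dd)))); last first.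
    by rewrite ler_wpM2l// divr_ge0 ?mulr_ge0 ?ltW.
  rewrite /M2 le_eqVlt; apply/orP; left; apply/eqP.
  by field; rewrite !gt_eqF.
- apply: exp_beats_linear => //; last exact: MD1 _ M3_le.
  apply/andP; split; first exact: ltW.
  by rewrite -(@ler_pXn2r _ 2)// nnegrE ltW.
- have DM4 := MD1 _ M4_le.
  have Dk : kk <= D.
    exact: le_trans kksq kD2.
  (* As dl < 1/5, the exponent is at least D / 40, and exp (- D / 40) <= 40 / D; this is the origin
     of [M4]. *)
  have ex : expR (- ((1 - 4 * dl) * (D / 8))) <= dl * alpha / 144.
    apply: (@le_trans _ _ (expR (- (D / 40)))).
      rewrite ler_expR lerN2 (_ : D / 40 = 1 / 5 * (D / 8)); last by field.
      by rewrite ler_wpM2r ?divr_ge0 ?(ltW D0)//; lra.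
    rewrite expRN -[leRHS]invrK lef_pV2 ?posrE ?expR_gt0 ?invr_gt0 ?divr_gt0 ?mulr_gt0//.
    apply: (@le_trans _ _ (D / 40)); last by have := expR_ge1Dx (D / 40); lra.
    rewrite invf_div ler_pdivlMr// mulrC; exact: DM4.
  rewrite /N0 -/kk -/P (_ : dl / 72 * _ = 2 * (P * (dl * alpha / 144 * (D / kk)))); last first.
    by field; rewrite gt_eqF.
  rewrite ler_pM2l// ler_pM2l//; apply: (le_trans ex).
  by rewrite ler_peMr ?divr_ge0 ?mulr_ge0 ?(ltW dl0) ?(ltW a0)// ler_pdivlMr// mul1r.
- have {eM} := le_trans (ler_norm _) eM.
  rewrite ler_pdivrMr ?divr_gt0 ?mulr_gt0// => /le_trans; apply.
  rewrite /N0 -/kk -/P le_eqVlt; apply/orP; left; apply/eqP.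
  by field; rewrite gt_eqF.
Unshelve. all: by end_near. Qed.

Theorem theorem4p1 (R : realType)
    (disp : nat -> measure_display)
    (Omega : forall p : nat, measurableType (disp p))
    (P : forall p : nat, probability (Omega p) R)
    (k d : nat -> nat)
    (zstar : forall p : nat, {ffun 'I_p -> 'I_(k p)})
    (theta : forall p : nat, 'I_(k p) -> 'rV[R]_(d p))
    (eps Y : forall p : nat, 'I_p -> Omega p -> 'rV[R]_(d p))
    (z : forall p : nat, nat -> Omega p -> {ffun 'I_p -> 'I_(k p)})
    (alpha : R) (eta e : nat -> R)
    (eps_gaussian : forall (p : nat) (j : 'I_p),
      std_gaussian_vector (P p) (eps p j))
    (eps_independent : forall p : nat, independent_vectors (P p) (eps p))
    (Y_model : forall (p : nat) (j : 'I_p) (w : Omega p),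
      Y p j w = theta p (zstar p j) + eps p j w)
    (signal : Delta_min (theta p) ^+ 2 /
        ((k p)%:R ^+ 2 * ((k p)%:R * (d p)%:R / p%:R + 1)) @[p --> \oo]
      --> +oo)
    (large_clusters : p%:R / (k p)%:R @[p --> \oo] --> (+oo : set_system R))
    (alpha_gt0 : 0 < alpha)
    (balanced : \forall p \near \oo, forall a : 'I_(k p),
      alpha * p%:R / (k p)%:R <= (cluster_size (zstar p) a)%:R)
    (z_random : forall p t : nat, random_labels (z p t))
    (z_lloyd : forall (p t : nat) (w : Omega p),
      lloyd_step (fun j => Y p j w) (z p t w) (z p t.+1 w))
    (e_small : e p / (p%:R * Delta_min (theta p) ^+ 2 / (k p)%:R)
        @[p --> \oo] --> (0 : R))
    (init : \forall p \near \oo,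
      ((1 - eta p)%:E <=
         P p [set w | (loss (theta p) (z p 0%N w) (zstar p) <= e p)%R])%E) :
  exists2 delta : nat -> R, delta p @[p --> \oo] --> (0 : R) &
    \forall p \near \oo,
      ((1 - eta p - expR (- Delta_min (theta p)) - p%:R^-1)%:E <=
         P p [set w | forall t : nat, (1 <= t)%N ->
           (loss (theta p) (z p t w) (zstar p) <=
              p%:R * expR (- ((1 + delta p) * (Delta_min (theta p) ^+ 2 / 8)))
              + 2^-1 * loss (theta p) (z p t.-1 w) (zstar p))%R])%E.
Proof.
pose bound p x : R := p%:R * expR (- ((1 - x) * (Delta_min (theta p) ^+ 2 / 8))).
pose Q p x := ((1 - eta p - expR (- Delta_min (theta p)) - p%:R^-1)%:E <=
  P p (recursion_event (theta p) (zstar p) (z p) (bound p x)))%E.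
have Q_mono p x y : x <= y -> Q p x -> Q p y.
  move=> xy /le_trans; apply; apply: recursion_event_le; first exact: z_random.
  rewrite ler_wpM2l// ler_expR lerN2 ler_wpM2r ?lerB//.
  by rewrite divr_ge0// sqr_ge0.
suff Q_near x : 0 < x -> \forall p \near \oo, Q p x.
  have [delta' delta0 Q_delta] := diagonal_slack Q_mono Q_near.
  exists (fun p => - delta' p) => //.
  by rewrite -oppr0; exact: cvgN.
(* The exponent loses 4 dl, so dl <= x / 4 suffices; the cap 1/6 secures dl < 1/5. *)
move=> x0; pose dl := Num.min (x / 4) (1 / 6).
have dl01 : 0 < dl < 1 / 5.
  apply/andP; split; first by rewrite lt_min divr_gt0//=; lra.
  by rewrite gt_min; apply/orP; right; lra.
have dlx : 4 * dl <= x.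
  have : dl <= x / 4 by rewrite ge_min lexx.
  lra.
have kap0 : 0 < dl ^+ 2 / 500.
  by rewrite divr_gt0 ?ltr0n// exprn_gt0//; case/andP: dl01.
have conditions := lloyd_conditions_near (fun p => Delta_min_ge0 (theta p))
  signal large_clusters alpha_gt0 dl01 kap0 e_small.
apply: filterS3 conditions balanced init => p.
move=> [[p0 Dm0 N00] [[noise_small N0_large N0_dim] [k_small tau_small e_le]]] sizes ini.
apply: Q_mono dlx _.
have [dl0 dl5] := andP dl01.
have dl4 : 0 < dl < 1 / 4 by apply/andP; split=> //; lra.
apply: (recursion_event_prob (z_random p) (eps_gaussian p) (eps_independent p) (Y_model p)
  (z_lloyd p) p0 dl4 Dm0 N00 (@Delta_min_le _ _ _ (theta p)) sizes (ltW kap0) _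
  noise_small N0_large N0_dim k_small tau_small e_le ini).
by rewrite mulrC divfK ?pnatr_eq0 ?lexx.
Qed.
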